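(* Let $n$ be a finite ordinal with $n>2$, let $\mathsf K$ be any one of the classes $\mathsf{Sc}$, $\mathsf{CA}$, $\mathsf{QA}$, $\mathsf{QEA}$, and let $m\geq n+3$. Then $\mathsf{RK}_n$ is not atom-canonical with respect to $\mathbf S\mathsf{Nr}_n\mathsf K_m$: there is an atomic algebra $\mathfrak A\in\mathsf{RK}_n$ such that $\mathfrak{Cm}\mathsf{At}\mathfrak A\notin\mathbf S\mathsf{Nr}_n\mathsf K_m$. In particular $\mathsf{RK}_n$ is not atom-canonical.
   Context: $\mathsf{Sc}_\alpha$ (Pinter's substitution algebras), $\mathsf{CA}_\alpha$ (cylindric algebras), $\mathsf{QA}_\alpha$ (quasi-polyadic algebras) and $\mathsf{QEA}_\alpha$ (quasi-polyadic equality algebras) are the usual varieties of $\alpha$-dimensional cylindric-like algebras (Boolean algebras with cylindrifications $c_i$, and, depending on the class, substitutions and/or diagonal constants $d_{ij}$, $i,j<\alpha$). $\mathsf{RK}_\alpha$ denotes the class of representable algebras in $\mathsf K_\alpha$ (subdirect products of the corresponding set algebras). For $n<m$ and $\mathfrak B\in\mathsf K_m$, the neat reduct $\mathfrak{Nr}_n\mathfrak B$ is the algebra with universe $\{x\in B: c_ix=x \text{ for all } n\le i<m\}$ and the operations of $\mathfrak B$ with indices $<n$; $\mathsf{Nr}_n\mathsf K_m=\{\mathfrak A:\mathfrak A\cong\mathfrak{Nr}_n\mathfrak B,\ \mathfrak B\in\mathsf K_m\}$, and $\mathbf S$ is closure under isomorphic copies of subalgebras. For an atomic completely additive Boolean algebra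 with operators $\mathfrak A$, $\mathsf{At}\mathfrak A$ is its atom structure and $\mathfrak{Cm}\mathsf{At}\mathfrak A$ the complex algebra over it (its Dedekind–MacNeille completion). A class $\mathsf L$ is not atom-canonical with respect to a class $\mathsf M$ if some atomic $\mathfrak D\in\mathsf L$ has $\mathfrak{Cm}\mathsf{At}\mathfrak D\notin\mathsf M$; a class is atom-canonical if it contains $\mathfrak{Cm}\mathsf{At}\mathfrak D$ for each of its atomic completely additive members $\mathfrak D$. *)

(* Defs.v *)
From mathcomp Require Import all_boot all_order.
From mathcomp Require Import boolp classical_sets.

Set Implicit Arguments.
Unset Strict Implicit.
Unset Printing Implicit Defensive.

Import Order.TTheory.

Local Open Scope order_scope.

(* Pinter's substitution algebras, cylindric algebras, quasi-polyadic algebras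
   and quasi-polyadic equality algebras. *)
Variant kind := Sc | CA | QA | QEA.

Definition has_subst K := if K is CA then false else true.
Definition has_transp K := if K is (QA | QEA) then true else false.
Definition has_diag K := if K is (CA | QEA) then true else false.

(* [Cyl i] is c_i; [Sub _ i j] is the replacement s^i_j of i by j;
   [Swap _ i j] is the transposition s_[i,j]. *)
Inductive opr (K : kind) (I : Type) : Type :=
| Cyl of I
| Sub of has_subst K & I & I
| Swap of has_transp K & I & I.
Arguments Cyl {K I}.
Arguments Sub {K I}.
Arguments Swap {K I}.

Inductive cst (K : kind) (I : Type) : Type :=
| Diag of has_diag K & I & I.
Arguments Diag {K I}.

Definition opr_map K I J (e : I -> J) (o : opr K I) : opr K J :=
  match o with
  | Cyl i => Cyl (e i)
  | Sub h i j => Sub h (e i) (e j)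
  | Swap h i j => Swap h (e i) (e j)
  end.

Definition cst_map K I J (e : I -> J) (d : cst K I) : cst K J :=
  match d with Diag h i j => Diag h (e i) (e j) end.

(* Boolean algebras with operators of the type of [K] and dimension [I]. *)
Record alg (K : kind) (I : Type) := Alg {
  alg_disp : Order.disp_t;
  carrier :> ctbDistrLatticeType alg_disp;
  unop : opr K I -> carrier -> carrier;
  const : cst K I -> carrier }.
Arguments Alg {K I alg_disp}.

Section Equations.
Variables (d : Order.disp_t) (B : ctbDistrLatticeType d) (I : eqType).
Implicit Types (x y : B) (i j k l : I).

Definition bool_endo (f : B -> B) :=
  (forall x y, f (x `|` y) = f x `|` f y) /\ (forall x, f (~` x) = ~` f x).

(* Pinter's equations; s i j is s^i_j. *)
Definition Sc_eqs (c : I -> B -> B) (s : I -> I -> B -> B) : Prop :=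
  (forall i, c i \bot = \bot) /\
  (forall i x, x <= c i x) /\
  (forall i x y, c i (x `&` c i y) = c i x `&` c i y) /\
  (forall i j x, c i (c j x) = c j (c i x)) /\
  (forall i x, s i i x = x) /\
  (forall i j, bool_endo (s i j)) /\
  (forall i j x, s i j (c i x) = c i x) /\
  (forall i j x, i != j -> c i (s i j x) = s i j x) /\
  (forall i j k x, k != i -> k != j -> s i j (c k x) = c k (s i j x)) /\
  (forall i j x, c i (s j i x) = c j (s i j x)) /\
  (forall i j k l x, uniq [:: i; j; k; l] ->
     s i j (s k l x) = s k l (s i j x)) /\
  (forall i j l x, s i l (s j i x) = s i l (s j l x)).

(* Henkin, Monk and Tarski's (C1)-(C7). *)
Definition CA_eqs (c : I -> B -> B) (dg : I -> I -> B) : Prop :=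
  (forall i, c i \bot = \bot) /\
  (forall i x, x <= c i x) /\
  (forall i x y, c i (x `&` c i y) = c i x `&` c i y) /\
  (forall i j x, c i (c j x) = c j (c i x)) /\
  (forall i, dg i i = \top) /\
  (forall i j k, i != j -> i != k -> dg j k = c i (dg j i `&` dg i k)) /\
  (forall i j x, i != j ->
     c i (dg i j `&` x) `&` c i (dg i j `&` ~` x) = \bot).

(* Sain and Thompson's axioms (finitary polyadic algebras), in which the finite
   substitutions are generated by replacements s and transpositions p. *)
Definition QA_eqs (c : I -> B -> B) (s p : I -> I -> B -> B) : Prop :=
  (forall i x, s i i x = x) /\
  (forall i x, p i i x = x) /\
  (forall i j x, p i j x = p j i x) /\
  (forall i x, x <= c i x) /\
  (forall i x y, c i (x `|` y) = c i x `|` c i y) /\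
  (forall i j x, s i j (c i x) = c i x) /\
  (forall i j x, i != j -> c i (s i j x) = s i j x) /\
  (forall i j k x, k != i -> k != j -> s i j (c k x) = c k (s i j x)) /\
  (forall i j, bool_endo (s i j)) /\
  (forall i j, bool_endo (p i j)) /\
  (forall i j x, p i j (p i j x) = x) /\
  (forall i j k x, uniq [:: i; j; k] -> p i j (p i k x) = p j k (p i j x)) /\
  (forall i j x, p i j (s i j x) = s j i x).

Definition QEA_eqs (c : I -> B -> B) (s p : I -> I -> B -> B)
    (dg : I -> I -> B) : Prop :=
  QA_eqs c s p /\
  (forall i j, s i j (dg i j) = \top) /\
  (forall i j x, x `&` dg i j <= s i j x).

End Equations.

Definition variety (K : kind) (I : eqType) : alg K I -> Prop :=
  match K return alg K I -> Prop with
  | Sc => fun A =>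
      Sc_eqs (fun i => @unop _ _ A (Cyl i))
             (fun i j => @unop _ _ A (Sub (K:=Sc) isT i j))
  | CA => fun A =>
      CA_eqs (fun i => @unop _ _ A (Cyl i))
             (fun i j => const A (Diag (K:=CA) isT i j))
  | QA => fun A =>
      QA_eqs (fun i => @unop _ _ A (Cyl i))
             (fun i j => @unop _ _ A (Sub (K:=QA) isT i j))
             (fun i j => @unop _ _ A (Swap (K:=QA) isT i j))
  | QEA => fun A =>
      QEA_eqs (fun i => @unop _ _ A (Cyl i))
              (fun i j => @unop _ _ A (Sub (K:=QEA) isT i j))
              (fun i j => @unop _ _ A (Swap (K:=QEA) isT i j))
              (fun i j => const A (Diag (K:=QEA) isT i j))
  end.

Definition hom K I (A B : alg K I) (f : A -> B) : Prop :=
  f \bot = \bot /\ f \top = \top /\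
  (forall x y, f (x `|` y) = f x `|` f y) /\
  (forall x y, f (x `&` y) = f x `&` f y) /\
  (forall x, f (~` x) = ~` f x) /\
  (forall o x, f (unop o x) = unop o (f x)) /\
  (forall c, f (const A c) = const B c).

(* S L: isomorphic copies of subalgebras of members of L. *)
Definition S_closure K I (L : alg K I -> Prop) (A : alg K I) : Prop :=
  exists C : alg K I, L C /\ exists f : A -> C, hom f /\ injective f.

Definition transp (I : eqType) (i j k : I) : I :=
  if k == i then j else if k == j then i else k.

Definition repl (I : eqType) (i j k : I) : I := if k == i then j else k.

(* The full set algebra, on all sets of I-sequences over U. *)
Definition full_set_alg (K : kind) (I : eqType) (U : Type) : alg K I :=
  @Alg K I _ (set (I -> U) : ctbDistrLatticeType _)
    (fun o (X : set (I -> U)) =>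
       match o with
       | Cyl i => [set f : I -> U | exists2 g, X g & forall j, j != i -> g j = f j]
       | Sub _ i j => [set f : I -> U | X (fun k => f (repl i j k))]
       | Swap _ i j => [set f : I -> U | X (fun k => f (transp i j k))]
       end%classic)
    (fun c => match c with Diag _ i j => [set f : I -> U | f i = f j] end%classic).

(* Set algebras are the subalgebras of full set algebras, here closed under
   isomorphism. *)
Definition set_algebra K (I : eqType) : alg K I -> Prop :=
  S_closure (fun C => exists U : Type, C = full_set_alg K I U).

Definition subdirect_product K I (L : alg K I -> Prop) (A : alg K I) : Prop :=
  exists (T : Type) (B : T -> alg K I) (h : forall t, A -> B t),
    (forall t, L (B t)) /\
    (forall t, hom (h t)) /\
    (forall t y, exists x, h t x = y) /\
    (forall x y, (forall t, h t x = h t y) -> x = y).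

Definition RK (K : kind) (n : nat) (A : alg K 'I_n) : Prop :=
  variety A /\ subdirect_product (@set_algebra K 'I_n) A.

(* An ordinal is given by a well-ordered type m; a finite ordinal k satisfies
   k <= m iff 'I_k is isomorphic to an initial segment of m, in which case the
   isomorphism is unique and e i is the i-th element of m. This covers infinite
   m as well as finite m. *)
Definition initial_segment (k : nat) d (m : orderType d) (e : 'I_k -> m) : Prop :=
  (forall i j : 'I_k, (i < j)%N -> e i < e j) /\
  (forall i y, y < e i -> exists j, e j = y).

Definition ord_le (k : nat) d (m : orderType d) : Prop :=
  exists e : 'I_k -> m, initial_segment e.

(* Forget the operations whose indices are not all in the image of e. *)
Definition reduct K I J (e : I -> J) (B : alg K J) : alg K I :=
  @Alg K I _ (carrier B) (fun o => @unop _ _ B (opr_map e o))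
    (fun c => @const _ _ B (cst_map e c)).

Definition neat_universe K I J (e : I -> J) (B : alg K J) : set B :=
  [set x | forall k : J, (forall i, e i <> k) -> unop (Cyl k) x = x]%classic.

Arguments neat_universe {K I J} e B _.

(* A is isomorphic to the subalgebra of the reduct of B with universe
   [neat_universe e B]. *)
Definition iso_neat_reduct K I J (e : I -> J) (B : alg K J) (A : alg K I) : Prop :=
  exists f : A -> reduct e B,
    hom f /\ injective f /\
    (forall y : B, neat_universe e B y <-> exists x, f x = y).

Definition NrK (K : kind) (n : nat) d (m : orderType d) (A : alg K 'I_n) : Prop :=
  exists (e : 'I_n -> m) (B : alg K m),
    initial_segment e /\ variety B /\ iso_neat_reduct e B A.

Definition SNrK (K : kind) (n : nat) d (m : orderType d) : alg K 'I_n -> Prop :=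
  S_closure (@NrK K n d m).

Definition is_atom d (B : ctbDistrLatticeType d) (a : B) : Prop :=
  a <> \bot /\ forall x : B, x <= a -> x = \bot \/ x = a.

Definition atomic K I (A : alg K I) : Prop :=
  forall x : A, x <> \bot -> exists2 a : A, is_atom a & a <= x.

Definition completely_additive K I (A : alg K I) : Prop :=
  forall (o : opr K I) (X : set A) (s : A),
    supremums X s -> supremums (@unop _ _ A o @` X)%classic (unop o s).

Record atom_structure (K : kind) (I : Type) := AtomStructure {
  points : Type;
  op_rel : opr K I -> points -> points -> Prop;
  cst_set : cst K I -> set points }.

Definition At K I (A : alg K I) : atom_structure K I :=
  @AtomStructure K I {a : A | is_atom a}
    (fun o a b => sval a <= unop o (sval b))
    (fun c => [set a | sval a <= const A c]%classic).

Definition Cm K I (S : atom_structure K I) : alg K I :=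
  @Alg K I _ (set (points S) : ctbDistrLatticeType _)
    (fun o X => [set a | exists2 b, X b & op_rel o a b]%classic)
    (@cst_set K I S).

Definition not_atom_canonical_wrt K I (L M : alg K I -> Prop) : Prop :=
  exists D : alg K I,
    L D /\ atomic D /\ completely_additive D /\ ~ M (Cm (At D)).

Definition atom_canonical K I (L : alg K I -> Prop) : Prop :=
  forall D : alg K I,
    L D -> atomic D -> completely_additive D -> L (Cm (At D)).

(* Main.v *)
(** The atoms of the algebra are the types of n-tuples in a countable structure M
    whose relation is a colour attached to a tuple p of k = n - 3 parameters and
    two further points. Points x and y may form a base over p; a point z is an
    apex over the base if both (p, x, z) and (p, y, z) are marked. Two apexes z, w
    of different sorts over the same base are joined by a red colour, because the
    mark at x excludes all white colours of (p, z, w) but one, and the mark at y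
    excludes that one. Reds between a distinguished sort c and the other
    sorts come in infinitely many copies l of two classes, and if c, z, w are
    pairwise joined by reds, then the colours of cz and cw belong to the same copy
    and to different classes. By the pigeonhole principle no base has apexes
    c, z1, z2, z3 of four different sorts. All these conditions concern n points
    at a time.

    M contains such bases nevertheless: there the colours of c z1, c z2, c z3 are
    an ideal red rho, which is matched with itself. The relations of M which for
    some N identify rho with all red copies from N on form an algebra of sets (a
    back-and-forth argument), and each nonempty one contains a tuple without rho.
    So its atoms are the types without rho, and in the complex algebra over them,
    where the union of all copies of a class is an element, the pigeonhole
    argument can be carried out. It involves the k + 2 points of the base and four
    apexes, that is, n + 3 dimensions. *)

Require Import Defs.
From HB Require Import structures.
From mathcomp Require Import all_boot all_order.
From mathcomp Require Import boolp classical_sets.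
From mathcomp Require Import zify.

Set Implicit Arguments.
Unset Strict Implicit.
Unset Printing Implicit Defensive.

(** * Coloured structures *)

(** The difficulty is to have one-point extensions and, at the same time, bases with apexes of four
    sorts. Besides the parameters a tuple has room for only three points, so it sees a base with one
    apex, one base point with two apexes, or three apexes, and each of these is easy to complete.
    Trouble comes from points outside the tuple: a third apex over an old base needs reds to the two
    apexes already there, and the mate condition then reacts on the old red between them. So the
    future of a base is announced in its white colour. A base newly put below two apexes, whatever
    red joins them, admits no third sort; a base that admits a third sort tolerates only the ideal
    red between the distinguished apex and another, and this red is its own mate. One algebra serves
    all four kinds: the definable relations are closed under every operation of a set algebra, and
    the refutation uses only laws of cylindrification and replacement that the four axiom systems
    share. It also refutes representability, because set algebras of dimension [n] embed into neat
    reducts of set algebras of dimension [n + 3]. *)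

(* [inl ts] is white; [inr None] is the ideal red, and [inr (Some (e, l))] is the
   red of class [e] in copy [l]. *)
Definition colour := (seq nat + option (bool * nat))%type.
Definition blank : colour := inl [::].
Definition mark : colour := inl [:: 0].
Definition rho : colour := inr None.
Definition isred (c : colour) := if c is inr _ then true else false.
Definition mate (c : colour) : colour :=
  if c is inr (Some (e, l)) then inr (Some (~~ e, l)) else c.
Definition allows (c : colour) t := if c is inl ts then t \in ts else false.

Definition colouring := seq nat -> nat -> nat -> colour.

(* The sorts below [k] are those of the parameters, so that the entries of [p] are
   distinct; [k] and [k.+1] are the sorts of the two points of a base, [k.+2] is
   the distinguished sort of apexes, and all larger sorts are sorts of apexes. *)
Definition params k (srt : nat -> nat) (p : seq nat) := map srt p = iota 0 k.

(* A white colour [inl ts] of the two points of a base lists the sorts of the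
   apexes that it admits. *)
Record consistent k (srt : nat -> nat) (col : colouring) (G : pred nat) : Prop :=
  Consistent {
  consX : forall p x z w, params k srt p -> all G [:: x, z, w & p] ->
    srt x = k -> k.+2 <= srt z -> k.+2 <= srt w -> srt z != srt w ->
    col p x z = mark -> col p x w = mark ->
    isred (col p z w) || (col p z w == mark);
  consY : forall p y z w, params k srt p -> all G [:: y, z, w & p] ->
    srt y = k.+1 -> k.+2 <= srt z -> k.+2 <= srt w -> srt z != srt w ->
    col p y z = mark -> col p y w = mark -> col p z w != mark;
  consS : forall p x y z, params k srt p -> all G [:: x, y, z & p] ->
    srt x = k -> srt y = k.+1 -> k.+2 <= srt z ->
    col p x z = mark -> col p y z = mark -> allows (col p x y) (srt z);
  consZ : forall p c z w, params k srt p -> all G [:: c, z, w & p] ->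
    srt c = k.+2 -> k.+2 < srt z -> k.+2 < srt w -> srt z != srt w ->
    isred (col p c z) -> isred (col p c w) -> isred (col p z w) ->
    col p c w = mate (col p c z) }.

(* [full_rho] concerns [n + 1] points and is therefore invisible in the types of
   [n]-tuples: if a base admits a third sort of apexes, then two apexes may only
   be joined by the ideal red, since otherwise a third one could not be added. *)
Record full_consistent k srt col (G : pred nat) : Prop := FullConsistent {
  full_cons :> consistent k srt col G;
  full_rho : forall p x y c w u, params k srt p -> all G [:: x, y, c, w & p] ->
    srt x = k -> srt y = k.+1 -> srt c = k.+2 -> k.+2 < srt w ->
    col p x c = mark -> col p y c = mark -> col p x w = mark -> col p y w = mark ->
    allows (col p x y) u -> u != k.+2 -> u != srt w -> col p c w = rho }.

(** * Adding one point to a fully consistent structure *)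

Section OnePoint.
Variables (k : nat) (srt : nat -> nat) (old : colouring) (v : nat) (F : seq nat)
  (gam : colouring).

Definition given : colouring := fun p a b =>
  if v \notin [:: a, b & p] then old p a b
  else if all (mem (v :: F)) [:: a, b & p] then gam p a b else blank.

(** Marks are read off [given] because [extend] is itself built from [common]; by [given_mark] both
    have the same marks between base points and apexes. *)
Definition common s p a b :=
  has (fun x => [&& srt x == s, given p x a == mark & given p x b == mark]) F.

(* The colour of a base created by default admits only the sorts of the apexes
   that it already has; there are at most two of them, since they lie in [F]. *)
Definition default : colouring := fun p a b =>
  if (srt a == k) && (srt b == k.+1) then
    inl [seq srt z | z <- F &
      [&& k.+2 <= srt z, given p a z == mark & given p b z == mark]]
  else if (k.+2 <= srt a) && (k.+2 <= srt b) then
    if common k p a b then if common k.+1 p a b then rho else mark else blank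
  else blank.

Definition extend : colouring := fun p a b =>
  if (v \in [:: a, b & p]) && ~~ all (mem (v :: F)) [:: a, b & p]
  then default p a b else given p a b.

Lemma params_lt p q : params k srt p -> q \in p -> srt q < k.
Proof. by move=> hp /(map_f srt); rewrite hp mem_iota. Qed.

Lemma uniq_points p qs : params k srt p -> all (fun q => k <= srt q) qs ->
  uniq qs -> uniq (qs ++ p).
Proof.
move=> hp hq uq; rewrite cat_uniq uq (@map_uniq _ _ srt) ?hp ?iota_uniq // andbT.
apply/hasPn => q /(params_lt hp) sq; apply/negP => /= qq.
by move/allP/(_ _ qq): hq; rewrite leqNgt sq.
Qed.

Lemma count_points p qs (A : seq nat) : params k srt p ->
  all (fun q => k <= srt q) qs -> uniq qs ->
  {subset qs ++ p <= A} -> size qs + k <= size A.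
Proof.
move=> hp hq uq sub.
have sp : size p = k by rewrite -(size_map srt) hp size_iota.
rewrite -sp -size_cat; apply: uniq_leq_size sub; exact: uniq_points.
Qed.

Hypothesis Fv : v \notin F.
Hypothesis sF : size F <= k.+2.

(** The [k] parameters are distinct and use up all but two points of [F], or all but three of
    [v :: F]. These two bounds carry all case distinctions below. *)
Lemma count_F p qs : params k srt p ->
  all (fun q => k <= srt q) qs -> uniq qs ->
  all (mem F) (qs ++ p) -> size qs <= 2.
Proof.
by move=> hp hq uq /allP sub; have := count_points hp hq uq sub; lia.
Qed.

Lemma count_vF p qs : params k srt p ->
  all (fun q => k <= srt q) qs -> uniq qs ->
  all (mem (v :: F)) (qs ++ p) -> size qs <= 3.
Proof.
by move=> hp hq uq /allP sub; have := count_points hp hq uq sub; rewrite /=; lia.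
Qed.

Lemma extend_old p a b : v \notin [:: a, b & p] -> extend p a b = old p a b.
Proof. by move=> h; rewrite /extend (negbTE h) /= /given h. Qed.

Lemma extend_new p a b : v \in [:: a, b & p] ->
  ~~ all (mem (v :: F)) [:: a, b & p] -> extend p a b = default p a b.
Proof. by move=> h1 h2; rewrite /extend h1 h2. Qed.

Lemma given_mark p x z : srt x <= k.+1 -> k.+2 <= srt z ->
  given p x z = extend p x z.
Proof.
move=> hx hz; rewrite /extend; case: ifP => // /andP[h1 h2].
rewrite /given h1 (negbTE h2) /= /default.
by rewrite ltnNge hx /= (_ : (srt z == _) = false) ?andbF //; lia.
Qed.

(** The default never creates a mark between a base point and an apex, so a mark that involves the
    new point was prescribed. *)
Lemma mark_in p x z : srt x <= k.+1 -> k.+2 <= srt z -> extend p x z = mark ->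
  v \in [:: x, z & p] -> all (mem (v :: F)) [:: x, z & p].
Proof.
move=> hx hz; rewrite -given_mark // /given => + h; rewrite h /=.
by case: ifP.
Qed.

Lemma commonP s p a b : s <= k.+1 -> k.+2 <= srt a -> k.+2 <= srt b ->
  reflect (exists x, [/\ x \in F, srt x = s, extend p x a = mark & extend p x b = mark])
    (common s p a b).
Proof.
move=> hs ha hb; apply: (iffP hasP) => [[x xF /and3P[/eqP sx]]|[x [xF sx ea eb]]].
  by rewrite !given_mark ?sx // => /eqP ? /eqP ?; exists x.
by exists x; rewrite // !given_mark ?sx // ea eb !eqxx.
Qed.

(** The values answer [consX] and [consY]: a common point of sort [k] asks for red or [mark], one of
    sort [k.+1] forbids [mark], and both together leave only red. The red chosen is [rho], which is
    its own mate. *)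
Lemma extend_ZZ p a b : k.+2 <= srt a -> k.+2 <= srt b ->
  v \in [:: a, b & p] -> ~~ all (mem (v :: F)) [:: a, b & p] ->
  extend p a b = if common k p a b then
    if common k.+1 p a b then rho else mark else blank.
Proof.
move=> ha hb h1 h2; rewrite /extend h1 h2 /default ha hb /=.
by rewrite (_ : (srt a == k) = false) //; lia.
Qed.

Lemma allows_XY p x y u : srt x = k -> srt y = k.+1 ->
  v \in [:: x, y & p] -> ~~ all (mem (v :: F)) [:: x, y & p] ->
  allows (extend p x y) u <-> exists z, [/\ z \in F, k.+2 <= srt z, srt z = u,
    extend p x z = mark & extend p y z = mark].
Proof.
move=> hx hy h1 h2; rewrite extend_new // /default hx hy !eqxx /=; split.
  move/mapP => -[z]; rewrite mem_filter => /andP[/and3P[hz]].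
  by rewrite !given_mark ?hx ?hy // => /eqP ? /eqP ? zF ->; exists z.
move=> [z [zF hz <- e1 e2]]; apply: map_f; rewrite mem_filter zF andbT hz /=.
by rewrite !given_mark ?hx ?hy // e1 e2 !eqxx.
Qed.

(** A default red needs common points of both base sorts in [F], and their marks at the new point
    are prescribed, which brings [p] into [v :: F]. If [v] were a parameter, the same marks would
    bring in [a] and [b] too. *)
Lemma default_red p a b : params k srt p -> k.+2 <= srt a -> k.+2 <= srt b ->
  srt a != srt b ->
  v \in [:: a, b & p] -> ~~ all (mem (v :: F)) [:: a, b & p] ->
  isred (extend p a b) -> [/\ extend p a b = rho, v \notin p, all (mem F) p &
   exists x y, [/\ x \in F, y \in F, srt x = k & srt y = k.+1] /\
    [/\ extend p x a = mark, extend p y a = mark,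
        extend p x b = mark & extend p y b = mark]].
Proof.
move=> hp ha hb ab h1 h2; rewrite extend_ZZ //.
case: (commonP p _ ha hb) => // -[x [xF sx xa xb]].
case: (commonP p _ ha hb) => // -[y [yF sy ya yb]] _.
have vp : v \notin p.
  apply: contra h2 => vp.
  have /and3P[_ aF pF] : all (mem (v :: F)) [:: x, a & p].
    by apply: mark_in; rewrite ?sx // !inE vp !orbT.
  have /and3P[_ bF _] : all (mem (v :: F)) [:: x, b & p].
    by apply: mark_in; rewrite ?sx // !inE vp !orbT.
  by apply/and3P.
have Fp : all (mem F) p.
  have : all (mem (v :: F)) p.
    move: h1; rewrite !inE (negbTE vp) orbF => /orP[]/eqP e.
      have /and3P[] // : all (mem (v :: F)) [:: x, a & p].
      by apply: mark_in; rewrite ?sx // e !inE eqxx orbT.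
    have /and3P[] // : all (mem (v :: F)) [:: x, b & p].
    by apply: mark_in; rewrite ?sx // e !inE eqxx orbT.
  move=> /allP h; apply/allP => q qp; have := h q qp; rewrite !inE.
  by case: eqP => // e; rewrite -e qp in vp.
by split=> //; exists x, y.
Qed.

Variable G : pred nat.
Hypothesis Gold : full_consistent k srt old G.
Hypothesis FG : all G F.
Hypothesis Gnew : consistent k srt extend (mem (v :: F)).
Let G' : pred nat := fun q => (q == v) || G q.

Lemma old_points s : v \notin s -> all G' s -> all G s.
Proof.
move=> vs /allP h; apply/allP => q qs; have := h q qs; rewrite /G'.
by case: eqP => // e; rewrite -e qs in vs.
Qed.

Lemma in_F q : q \in v :: F -> v != q -> q \in F.
Proof. by rewrite inE eq_sym; case: eqP. Qed.

Lemma sort_neq x z : srt x != srt z -> x != z.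
Proof. by apply: contraNneq => ->. Qed.

(** If [v] were [x] or a parameter, both marks would be prescribed and all points would lie in
    [v :: F]. So [v] is one of the apexes, [x] lies in [F], and the pair of apexes has its default
    colour. *)
Lemma step_XX s p x z w : s <= k.+1 -> params k srt p -> srt x = s ->
  k.+2 <= srt z -> k.+2 <= srt w ->
  ~~ all (mem (v :: F)) [:: x, z, w & p] -> v \in [:: x, z, w & p] ->
  extend p x z = mark -> extend p x w = mark ->
  [/\ v \in [:: z, w & p], ~~ all (mem (v :: F)) [:: z, w & p] & common s p z w].
Proof.
move=> hs hp sx hz hw nF vin xz xw.
have sx' : srt x <= k.+1 by rewrite sx.
have vxp : v \notin x :: p.
  apply: contra nF; rewrite inE => vxp.
  have /and3P[xF zF pF] : all (mem (v :: F)) [:: x, z & p].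
    by apply: mark_in; rewrite // !inE; case/orP: vxp => ->; rewrite ?orbT.
  have /and3P[_ wF _] : all (mem (v :: F)) [:: x, w & p].
    by apply: mark_in; rewrite // !inE; case/orP: vxp => ->; rewrite ?orbT.
  exact/and4P.
move: vxp vin; rewrite !inE negb_or => /andP[/negbTE vx /negbTE vp].
rewrite vx vp /= orbF => vzw.
have xF : x \in v :: F.
  case/orP: vzw => vz.
    have /and3P[] // : all (mem (v :: F)) [:: x, z & p].
    by apply: mark_in; rewrite // !inE vz orbT.
  have /and3P[] // : all (mem (v :: F)) [:: x, w & p].
  by apply: mark_in; rewrite // !inE vz orbT.
split; first by case/orP: vzw => ->; rewrite ?orbT.
  by apply: contra nF => h; apply/andP.
by apply/commonP => //; exists x; split=> //; apply: in_F xF _; rewrite vx.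
Qed.

(** If [v] is the apex or a parameter, the marks put all points into [v :: F]. If [v] belongs to the
    base, its mark puts the apex into [F], where the default colour of the base lists its sort. *)
Lemma step_S p x y z : params k srt p -> all G' [:: x, y, z & p] ->
  srt x = k -> srt y = k.+1 -> k.+2 <= srt z ->
  extend p x z = mark -> extend p y z = mark -> allows (extend p x y) (srt z).
Proof.
move=> hp hG sx sy hz xz yz.
case: (boolP (all (mem (v :: F)) [:: x, y, z & p])) => [|nF].
  by move/(consS Gnew hp); apply.
case: (boolP (v \in [:: x, y, z & p])) => [vin|vout]; last first.
  move: (vout); rewrite !inE !negb_or => /and4P[vx vy vz vp].
  rewrite extend_old ?inE ?negb_or ?vx ?vy //.
  apply: (consS Gold hp (old_points vout hG) sx sy hz).
    by rewrite -extend_old ?inE ?negb_or ?vx ?vz.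
  by rewrite -extend_old ?inE ?negb_or ?vy ?vz.
have vzp : v \notin z :: p.
  apply: contra nF; rewrite inE => vzp.
  have /and3P[xF zF pF] : all (mem (v :: F)) [:: x, z & p].
    by apply: mark_in; rewrite ?sx // !inE; case/orP: vzp => ->; rewrite ?orbT.
  have /and3P[yF _ _] : all (mem (v :: F)) [:: y, z & p].
    by apply: mark_in; rewrite ?sy // !inE; case/orP: vzp => ->; rewrite ?orbT.
  exact/and4P.
move: vzp vin; rewrite !inE negb_or => /andP[vz /negbTE vp].
rewrite (negbTE vz) vp /= orbF => vxy.
have zF : z \in v :: F.
  case/orP: vxy => vx.
    have /and3P[] // : all (mem (v :: F)) [:: x, z & p].
    by apply: mark_in; rewrite ?sx // !inE vx.
  have /and3P[] // : all (mem (v :: F)) [:: y, z & p].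
  by apply: mark_in; rewrite ?sy // !inE vx.
apply/allows_XY => //.
- by rewrite !inE; case/orP: vxy => ->; rewrite ?orbT.
- by apply: contra nF => /and3P[xF yF pF]; apply/and4P.
by exists z; split=> //; apply: in_F.
Qed.

Lemma step_rho p x y c w u : params k srt p -> all G' [:: x, y, c, w & p] ->
  srt x = k -> srt y = k.+1 -> srt c = k.+2 -> k.+2 < srt w ->
  extend p x c = mark -> extend p y c = mark ->
  extend p x w = mark -> extend p y w = mark ->
  allows (extend p x y) u -> u != k.+2 -> u != srt w -> extend p c w = rho.
Proof.
move=> hp hG sx sy sc sw xc yc xw yw hu uc uw.
have xy : x != y by apply: sort_neq; lia.
have xc' : x != c by apply: sort_neq; lia.
have xw' : x != w by apply: sort_neq; lia.
have yc' : y != c by apply: sort_neq; lia.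
have yw' : y != w by apply: sort_neq; lia.
have cw : c != w by apply: sort_neq; lia.
have nF : ~~ all (mem (v :: F)) [:: x, y, c, w & p].
  apply/negP => h; suff : size [:: x; y; c; w] <= 3 by [].
  apply: (@count_vF p [:: x; y; c; w] hp _ _ h).
    by apply/and5P; split=> //; lia.
  by rewrite /= !inE !negb_or xy xc' xw' yc' yw' cw.
have cin a b : srt a <= k.+1 -> k.+2 <= srt b -> extend p a b = mark ->
    v \in [:: a, b & p] -> [/\ a \in v :: F, b \in v :: F & all (mem (v :: F)) p].
  by move=> ha hb e vab; apply/and3P; apply: mark_in.
have [sx' sy'] : srt x <= k.+1 /\ srt y <= k.+1 by lia.
have [sc' sw'] : k.+2 <= srt c /\ k.+2 <= srt w by lia.
case: (boolP (v \in [:: x, y, c, w & p])) => [vin|vout]; last first.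
  move: (vout); rewrite !inE !negb_or => /and5P[vx vy vc vw vp].
  have ex a b : v != a -> v != b -> extend p a b = old p a b.
    by move=> va vb; rewrite extend_old // !inE !negb_or va vb.
  rewrite ex //; rewrite ex // in hu.
  by apply: (full_rho Gold hp (old_points vout hG) _ _ _ _ _ _ _ _ hu);
    rewrite // -ex.
case: (boolP (v \in p)) => vp.
  have vab a b : v \in [:: a, b & p] by rewrite !inE vp !orbT.
  case/negP: nF; have [xF cF pF] := cin _ _ sx' sc' xc (vab _ _).
  have [yF wF _] := cin _ _ sy' sw' yw (vab _ _).
  by apply/andP; split=> //; apply/and4P.
have inF q : v != q -> q \in v :: F -> q \in F by move=> h /in_F; apply.
have pF' : all (mem (v :: F)) p -> all (mem F) p.
  move=> /allP h; apply/allP => q qp; apply: inF (h _ qp).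
  by apply: contraNneq vp => ->.
case: (boolP ((v == x) || (v == y))) => [vxy|].
  have [cF wF pF] : [/\ c \in v :: F, w \in v :: F & all (mem (v :: F)) p].
    have vab a b : v == a -> v \in [:: a, b & p] by rewrite inE => ->.
    case/orP: vxy => e.
      have [_ ? ?] := cin _ _ sx' sc' xc (vab _ _ e).
      by have [] := cin _ _ sx' sw' xw (vab _ _ e).
    have [_ ? ?] := cin _ _ sy' sc' yc (vab _ _ e).
    by have [] := cin _ _ sy' sw' yw (vab _ _ e).
  have nxy : ~~ all (mem (v :: F)) [:: x, y & p].
    apply: contra nF => /and3P[xF yF _]; apply/andP; split=> //.
    by apply/and4P.
  have vxy' : v \in [:: x, y & p] by rewrite !inE orbA vxy.
  have [z [zF sz szu _ _]] := (allows_XY u sx sy vxy' nxy).1 hu.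
  suff : size [:: c; w; z] <= 2 by [].
  have cz : c != z by apply: sort_neq; rewrite sc szu eq_sym.
  have wz : w != z by apply: sort_neq; rewrite szu eq_sym.
  have [vc vw] : v != c /\ v != w.
    by case/orP: vxy => /eqP ->.
  apply: (count_F hp); first by apply/and4P; split=> //; exact: ltnW (ltnW _).
    by rewrite /= !inE !negb_or cw cz wz.
  by apply/and4P; split; [exact: inF|exact: inF|exact: zF|exact: pF'].
rewrite negb_or => /andP[vx vy].
move: vin; rewrite !inE (negbTE vx) (negbTE vy) (negbTE vp) orbF /= => vcw.
have [xF yF pF] : [/\ x \in v :: F, y \in v :: F & all (mem (v :: F)) p].
  have vab a b : v == b -> v \in [:: a, b & p] by rewrite !inE => ->; rewrite orbT.
  case/orP: vcw => e.
    have [? _ ?] := cin _ _ sx' sc' xc (vab _ _ e).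
    by have [] := cin _ _ sy' sc' yc (vab _ _ e).
  have [? _ ?] := cin _ _ sx' sw' xw (vab _ _ e).
  by have [] := cin _ _ sy' sw' yw (vab _ _ e).
rewrite extend_ZZ //.
- case: commonP => // [_|[]]; last by exists x; split=> //; apply: inF.
  by case: commonP => // -[]; exists y; split=> //; apply: inF.
- by rewrite !inE orbA vcw.
by apply: contra nF => /and3P[? ? _]; apply/andP; split=> //; apply/and4P.
Qed.

(** In the mixed case some red is a default one, so [F] contains the parameters and a base and, by
    counting, no apex; hence both reds at [v] are default. If [v] is [c], both are [rho]. Otherwise
    the three points are apexes over one base, which admits the sort of [v] by [step_S], and
    [step_rho] turns the old red into [rho]. *)
Lemma step_Z p c z w : params k srt p -> all G' [:: c, z, w & p] ->
  srt c = k.+2 -> k.+2 < srt z -> k.+2 < srt w -> srt z != srt w ->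
  isred (extend p c z) -> isred (extend p c w) -> isred (extend p z w) ->
  extend p c w = mate (extend p c z).
Proof.
move=> hp hG sc sz sw zw rcz rcw rzw.
case: (boolP (all (mem (v :: F)) [:: c, z, w & p])) => [|nF].
  by move/(consZ Gnew hp); apply.
case: (boolP (v \in [:: c, z, w & p])) => [vin|vout]; last first.
  move: (vout); rewrite !inE !negb_or => /and4P[vc vz vw vp].
  have ex a b : v != a -> v != b -> extend p a b = old p a b.
    by move=> va vb; rewrite extend_old // !inE !negb_or va vb.
  rewrite ex // ex //.
  by apply: (consZ Gold hp (old_points vout hG)) => //; rewrite -ex.
have [sc' sz' sw'] : [/\ k.+2 <= srt c, k.+2 <= srt z & k.+2 <= srt w].
  by split; lia.
have cz : srt c != srt z by lia.
have cw : srt c != srt w by lia.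
have dcz := default_red hp sc' sz' cz _ _ rcz.
have dcw := default_red hp sc' sw' cw _ _ rcw.
have dzw := default_red hp sz' sw' zw _ _ rzw.
have inF q : v != q -> q \in v :: F -> q \in F by move=> h /in_F; apply.
have vp : v \notin p.
  apply/negP => vp.
  have vab a b : v \in [:: a, b & p] by rewrite !inE vp !orbT.
  case: (boolP (all (mem (v :: F)) [:: c, z & p])) => [h1|].
    case: (boolP (all (mem (v :: F)) [:: c, w & p])) => [h2|].
      case/negP: nF; case/and3P: h1 => ? ? ?; case/and3P: h2 => ? ? ?.
      exact/and4P.
    by move/(dcw (vab _ _)) => []; rewrite vp.
  by move/(dcz (vab _ _)) => []; rewrite vp.
have baseU x y q : all (mem F) p -> x \in F -> y \in F -> q \in F ->
    srt x = k -> srt y = k.+1 -> k <= srt q -> q = x \/ q = y.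
  move=> pF xF yF qF sx sy sq.
  have [->|xq] := eqVneq q x; first by left.
  have [->|yq] := eqVneq q y; first by right.
  suff : size [:: x; y; q] <= 2 by [].
  have xy : x != y by apply: sort_neq; rewrite sx sy ltn_eqF.
  apply: (count_F hp); first by rewrite /= sx sy sq leqnn leqnSn.
    by rewrite /= !inE !negb_or xy ![_ == q]eq_sym xq yq.
  by apply/and4P; split.
have noF x y q : all (mem F) p -> x \in F -> y \in F ->
    srt x = k -> srt y = k.+1 -> k.+2 <= srt q -> v != q -> q \notin v :: F.
  move=> pF xF yF sx sy sq vq; apply/negP => /(inF _ vq) qF.
  have [|e|e] := baseU x y q pF xF yF qF sx sy; first exact: ltnW (ltnW sq).
    by rewrite e sx ltnNge leqnSn in sq.
  by rewrite e sy ltnn in sq.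
have same x y x' y' : all (mem F) p -> x \in F -> y \in F -> x' \in F ->
    y' \in F -> srt x = k -> srt y = k.+1 -> srt x' = k -> srt y' = k.+1 ->
    x' = x /\ y' = y.
  move=> pF xF yF xF' yF' sx sy sx' sy'; split.
    have [|//|e] := baseU x y x' pF xF yF xF' sx sy; first by rewrite sx'.
    by move: sx'; rewrite e sy => /eqP; rewrite gtn_eqF.
  have [|e|//] := baseU x y y' pF xF yF yF' sx sy; first by rewrite sy'.
  by move: sy'; rewrite e sx => /eqP; rewrite ltn_eqF.
have G'F q : q \in F -> G' q by move=> /(allP FG); rewrite /G' => ->; rewrite orbT.
have nab a b : b \notin v :: F -> ~~ all (mem (v :: F)) [:: a, b & p].
  by apply: contra => /and3P[].
have nab' a b : a \notin v :: F -> ~~ all (mem (v :: F)) [:: a, b & p].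
  by apply: contra => /and3P[].
have v1 b : v \in [:: v, b & p] by rewrite inE eqxx.
have v2 b : v \in [:: b, v & p] by rewrite !inE eqxx orbT.
have [cz' cw' zw'] : [/\ c != z, c != w & z != w] by split; apply: sort_neq.
move: vin; rewrite !inE (negbTE vp) orbF => /or3P[] /eqP e; [subst c|subst z|subst w].
- have [pF [x [y [[xF yF sx sy] _]]]] : all (mem F) p /\ exists x y,
      [/\ x \in F, y \in F, srt x = k & srt y = k.+1] /\ True.
    case: (boolP (all (mem (v :: F)) [:: v, z & p])) => [h1|].
      case: (boolP (all (mem (v :: F)) [:: v, w & p])) => [h2|].
        case/negP: nF; case/and3P: h1 => ? ? ?; case/and3P: h2 => ? ? ?.
        exact/and4P.
      by move/(dcw (v1 _)) => [_ _ ? [x [y [? _]]]]; split=> //; exists x, y.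
    by move/(dcz (v1 _)) => [_ _ ? [x [y [? _]]]]; split=> //; exists x, y.
  have [-> _ _ _] := dcz (v1 _) (nab _ _ (noF x y z pF xF yF sx sy sz' cz')).
  by have [-> _ _ _] := dcw (v1 _) (nab _ _ (noF x y w pF xF yF sx sy sw' cw')).
- have [zc wz] : v != c /\ v != w by rewrite eq_sym.
  have [pF [x [y [[xF yF sx sy] _]]]] : all (mem F) p /\ exists x y,
      [/\ x \in F, y \in F, srt x = k & srt y = k.+1] /\ True.
    case: (boolP (all (mem (v :: F)) [:: c, v & p])) => [h1|].
      case: (boolP (all (mem (v :: F)) [:: v, w & p])) => [h2|].
        case/negP: nF; case/and3P: h1 => ? ? ?; case/and3P: h2 => ? ? ?.
        exact/and4P.
      by move/(dzw (v1 _)) => [_ _ ? [x [y [? _]]]]; split=> //; exists x, y.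
    by move/(dcz (v2 _)) => [_ _ ? [x [y [? _]]]]; split=> //; exists x, y.
  have [-> _ _ [x1 [y1 [[x1F y1F sx1 sy1] [xc yc xz yz]]]]] :=
    dcz (v2 _) (nab' _ _ (noF x y c pF xF yF sx sy sc' zc)).
  have [_ _ _ [x2 [y2 [[x2F y2F sx2 sy2] [xz2 yz2 xw yw]]]]] :=
    dzw (v1 _) (nab _ _ (noF x y w pF xF yF sx sy sw' wz)).
  have [ex ey] := same _ _ _ _ pF x1F y1F x2F y2F sx1 sy1 sx2 sy2; subst x2 y2.
  apply: (step_rho hp _ sx1 sy1 sc sw xc yc xw yw
    (step_S hp _ sx1 sy1 sz' xz yz)) => //; last by rewrite gtn_eqF.
    by case/and4P: hG => gc gz gw gp; apply/and5P; split=> //; apply: G'F.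
  by case/and4P: hG => gc gz gw gp; apply/and4P; split=> //; apply: G'F.
- have [wc wz] : v != c /\ v != z by rewrite ![v == _]eq_sym.
  have [pF [x [y [[xF yF sx sy] _]]]] : all (mem F) p /\ exists x y,
      [/\ x \in F, y \in F, srt x = k & srt y = k.+1] /\ True.
    case: (boolP (all (mem (v :: F)) [:: c, v & p])) => [h1|].
      case: (boolP (all (mem (v :: F)) [:: z, v & p])) => [h2|].
        case/negP: nF; case/and3P: h1 => ? ? ?; case/and3P: h2 => ? ? ?.
        exact/and4P.
      by move/(dzw (v2 _)) => [_ _ ? [x [y [? _]]]]; split=> //; exists x, y.
    by move/(dcw (v2 _)) => [_ _ ? [x [y [? _]]]]; split=> //; exists x, y.
  have [-> _ _ [x1 [y1 [[x1F y1F sx1 sy1] [xc yc xw yw]]]]] :=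
    dcw (v2 _) (nab' _ _ (noF x y c pF xF yF sx sy sc' wc)).
  have [_ _ _ [x2 [y2 [[x2F y2F sx2 sy2] [xz yz xw2 yw2]]]]] :=
    dzw (v2 _) (nab' _ _ (noF x y z pF xF yF sx sy sz' wz)).
  have [ex ey] := same _ _ _ _ pF x1F y1F x2F y2F sx1 sy1 sx2 sy2; subst x2 y2.
  suff -> : extend p c z = rho by [].
  apply: (step_rho hp _ sx1 sy1 sc sz xc yc xz yz
    (step_S hp _ sx1 sy1 sw' xw yw)).
  + by case/and4P: hG => gc gz gw gp; apply/and5P; split=> //; apply: G'F.
  + by case/and4P: hG => gc gz gw gp; apply/and4P; split=> //; apply: G'F.
  + by rewrite gtn_eqF.
  + by rewrite eq_sym.
Qed.

Lemma full_consistent_extend : full_consistent k srt extend G'.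
Proof.
split; last exact: step_rho.
split.
- move=> p x z w hp hG sx hz hw zw xz xw.
  case: (boolP (all (mem (v :: F)) [:: x, z, w & p])) => [|nF].
    by move/(consX Gnew hp); apply.
  case: (boolP (v \in [:: x, z, w & p])) => [vin|vout].
    have [h1 h2 h3] := step_XX (leqnSn k) hp sx hz hw nF vin xz xw.
    by rewrite extend_ZZ // h3; case: ifP; rewrite ?eqxx ?orbT.
  move: (vout); rewrite !inE !negb_or => /and4P[vx vz vw vp].
  have ex a b : v != a -> v != b -> extend p a b = old p a b.
    by move=> va vb; rewrite extend_old // !inE !negb_or va vb.
  rewrite !ex // in xz xw *.
  exact: (consX Gold hp (old_points vout hG) sx hz hw zw xz xw).
- move=> p y z w hp hG sy hz hw zw yz yw.
  case: (boolP (all (mem (v :: F)) [:: y, z, w & p])) => [|nF].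
    by move/(consY Gnew hp); apply.
  case: (boolP (v \in [:: y, z, w & p])) => [vin|vout].
    have [h1 h2 h3] := step_XX (leqnn k.+1) hp sy hz hw nF vin yz yw.
    by rewrite extend_ZZ // h3; case: ifP.
  move: (vout); rewrite !inE !negb_or => /and4P[vx vz vw vp].
  have ex a b : v != a -> v != b -> extend p a b = old p a b.
    by move=> va vb; rewrite extend_old // !inE !negb_or va vb.
  rewrite !ex // in yz yw *.
  exact: (consY Gold hp (old_points vout hG) sy hz hw zw yz yw).
- exact: step_S.
- exact: step_Z.
Qed.

End OnePoint.

(** The conditions express distinctness of points through sorts only, so they are inherited along
    every map that preserves sorts and colours, injective or not. *)
Lemma consistent_pullback k srt col (G : pred nat) srt' col' (G' : pred nat)
    (P : nat -> nat) :
  (forall q, G q -> G' (P q) /\ srt q = srt' (P q)) ->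
  (forall p a b, size p = k -> all G [:: a, b & p] ->
     col p a b = col' (map P p) (P a) (P b)) ->
  consistent k srt' col' G' -> consistent k srt col G.
Proof.
move=> hG hc C'.
have sP p : params k srt p -> size p = k.
  by move=> hp; rewrite -(size_map srt) hp size_iota.
have hP p : params k srt p -> all G p -> params k srt' (map P p) /\ all G' (map P p).
  move=> hp /allP h; split; last by apply/allP => _ /mapP[q /h /hG[? _] ->].
  by rewrite /params -map_comp -hp; apply/esym/eq_in_map => q /h /hG[_ ->].
split.
- move=> p x z w hp /and4P[Gx Gz Gw Gp].
  have [[hx ->] [hz ->] [hw ->]] := And3 (hG _ Gx) (hG _ Gz) (hG _ Gw).
  have [hp1 hp2] := hP _ hp Gp.
  have E a b : G a -> G b -> col p a b = col' (map P p) (P a) (P b).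
    by move=> Ga Gb; apply: hc; [exact: sP | apply/and3P].
  rewrite !E //.
  by apply: (consX C' hp1); apply/and4P.
- move=> p x z w hp /and4P[Gx Gz Gw Gp].
  have [[hx ->] [hz ->] [hw ->]] := And3 (hG _ Gx) (hG _ Gz) (hG _ Gw).
  have [hp1 hp2] := hP _ hp Gp.
  have E a b : G a -> G b -> col p a b = col' (map P p) (P a) (P b).
    by move=> Ga Gb; apply: hc; [exact: sP | apply/and3P].
  rewrite !E //.
  by apply: (consY C' hp1); apply/and4P.
- move=> p x z w hp /and4P[Gx Gz Gw Gp].
  have [[hx ->] [hz ->] [hw ->]] := And3 (hG _ Gx) (hG _ Gz) (hG _ Gw).
  have [hp1 hp2] := hP _ hp Gp.
  have E a b : G a -> G b -> col p a b = col' (map P p) (P a) (P b).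
    by move=> Ga Gb; apply: hc; [exact: sP | apply/and3P].
  rewrite !E //.
  by apply: (consS C' hp1); apply/and4P.
- move=> p x z w hp /and4P[Gx Gz Gw Gp].
  have [[hx ->] [hz ->] [hw ->]] := And3 (hG _ Gx) (hG _ Gz) (hG _ Gw).
  have [hp1 hp2] := hP _ hp Gp.
  have E a b : G a -> G b -> col p a b = col' (map P p) (P a) (P b).
    by move=> Ga Gb; apply: hc; [exact: sP | apply/and3P].
  rewrite !E //.
  by apply: (consZ C' hp1); apply/and4P.
Qed.

Lemma consistent_sub k srt col (G G' : pred nat) : (forall q, G q -> G' q) ->
  consistent k srt col G' -> consistent k srt col G.
Proof.
move=> h; apply: (@consistent_pullback _ _ _ _ _ _ _ id) => [q /h|] // p a b _ _.
by rewrite map_id.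
Qed.

Lemma consistent_eq k srt col col' (G : pred nat) :
  (forall p a b, size p = k -> all G [:: a, b & p] -> col p a b = col' p a b) ->
  consistent k srt col' G -> consistent k srt col G.
Proof.
move=> h; apply: (@consistent_pullback _ _ _ _ _ _ _ id) => // p a b sp hp.
by rewrite map_id h.
Qed.

Lemma full_consistent_ext k srt col col' (G G' : pred nat) :
  (forall q, G q -> G' q) ->
  (forall p a b, size p = k -> all G [:: a, b & p] -> col p a b = col' p a b) ->
  full_consistent k srt col' G' -> full_consistent k srt col G.
Proof.
move=> hG hc C; split.
  by apply: (consistent_eq hc); apply: consistent_sub hG C.
move=> p x y c w u hp /and5P[Gx Gy Gc Gw Gp].
have sp : size p = k by rewrite -(size_map srt) hp size_iota.
rewrite !hc //; try exact/and3P.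
apply: (full_rho C hp); apply/and5P; split; rewrite ?hG //.
by apply/allP => q /(allP Gp)/hG.
Qed.

(** * The model *)

Section Model.
Variable k : nat.

(* Point [v] is created on demand: the demand consists of its sort, of a list of
   older points, and of the coded colours that involve [v] and these points. The
   last component of the encoded pair only serves to repeat every demand at later
   stages. *)
Definition demand (v : nat) : nat * seq nat * seq colour :=
  if @unpickle (nat * seq nat * seq colour * nat)%type v is Some (d, _) then d
  else (0, [::], [::]).

(* A demand refers to the point that it creates as [0] and to [q] as [q.+1]. *)
Definition shift (v q : nat) := if q == v then 0 else q.+1.

Definition demanded v : colouring := fun p a b =>
  nth blank (demand v).2 (pickle (map (shift v) p, shift v a, shift v b)).

Definition point_sort v := (demand v).1.1.
Local Notation srt := point_sort.

(** Plain consistency suffices for a demand: the [k + 4] points that [full_rho] speaks of do not fit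
    into [v :: F]. *)
Definition admissible v (F : seq nat) (c : colouring) :=
  [/\ all (fun q => q < v) F, size F <= k.+2 & consistent k srt c (mem (v :: F))].

Fixpoint approx (t : nat) : colouring :=
  if t is v.+1 then
    let c := extend k srt (approx v) v (demand v).1.2 (demanded v) in
    if `[< admissible v (demand v).1.2 c >] then c
    (* A demand that cannot be met still yields a point, with all colours blank, so that every
       natural number is a point. *)
    else extend k srt (approx v) v [::] (fun _ _ _ => blank)
  else fun _ _ _ => blank.

Definition edge_colour : colouring := fun p a b =>
  approx (foldr maxn 0 [:: a, b & p]).+1 p a b.

Local Notation col := edge_colour.

Lemma foldr_maxn_leq (s : seq nat) m : (foldr maxn 0 s <= m) = all (leq^~ m) s.
Proof. by elim: s => //= a s IH; rewrite geq_max IH. Qed.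

Lemma approxS t p a b : t \notin [:: a, b & p] -> approx t.+1 p a b = approx t p a b.
Proof. by move=> h; rewrite /=; case: ifP => _; rewrite extend_old. Qed.

Lemma approx_stable t p a b : all (fun q => q < t) [:: a, b & p] ->
  approx t p a b = col p a b.
Proof.
rewrite /edge_colour; set s := foldr _ _ _ => h.
have hs : all (leq^~ s) [:: a, b & p] by rewrite -foldr_maxn_leq.
have st : s < t.
  by case: t h => [//|t h]; rewrite ltnS foldr_maxn_leq; exact: h.
elim: t st {h} => // t IH; rewrite ltnS leq_eqVlt => /orP[/eqP->//|st].
rewrite approxS ?IH //; apply/negP => /(allP hs) /=; lia.
Qed.

Lemma approx_consistent t : full_consistent k srt (approx t) (fun q => q < t).
Proof.
have sub v : forall q, q < v.+1 -> (q == v) || (q < v).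
  by move=> q; rewrite ltnS leq_eqVlt.
elim: t => [|v IH]; first by split; first split; by [].
rewrite /=; case: asboolP => [[hF sF hc]|_].
  have vF : v \notin (demand v).1.2 by apply/negP => /(allP hF); rewrite ltnn.
  exact: full_consistent_ext (sub v) _ (full_consistent_extend vF sF IH hF hc).
apply: full_consistent_ext (sub v) _ (full_consistent_extend _ _ IH _ _) => //.
have one q : q \in [:: v] -> q = v by rewrite inE => /eqP.
split=> p x z w hp /and4P[/one-> /one-> /one-> _];
  rewrite ?eqxx //; move=> -> //; lia.
Qed.

Lemma col_consistent : full_consistent k srt col predT.
Proof.
have large (s : seq nat) : exists t, all (fun q => q < t) s.
  exists (foldr maxn 0 s).+1.
  by have := leqnn (foldr maxn 0 s); rewrite {1}foldr_maxn_leq.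
split; first split.
- move=> p x z w hp _; have [t /and4P[? ? ? ?]] := large [:: x, z, w & p].
  rewrite -!(@approx_stable t); try exact/and3P.
  by apply: (consX (approx_consistent t) hp); apply/and4P.
- move=> p x z w hp _; have [t /and4P[? ? ? ?]] := large [:: x, z, w & p].
  rewrite -!(@approx_stable t); try exact/and3P.
  by apply: (consY (approx_consistent t) hp); apply/and4P.
- move=> p x z w hp _; have [t /and4P[? ? ? ?]] := large [:: x, z, w & p].
  rewrite -!(@approx_stable t); try exact/and3P.
  by apply: (consS (approx_consistent t) hp); apply/and4P.
- move=> p x z w hp _; have [t /and4P[? ? ? ?]] := large [:: x, z, w & p].
  rewrite -!(@approx_stable t); try exact/and3P.
  by apply: (consZ (approx_consistent t) hp); apply/and4P.
move=> p x y c w u hp _; have [t /and5P[? ? ? ? ?]] := large [:: x, y, c, w & p].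
rewrite -!(@approx_stable t); try exact/and3P.
by apply: (full_rho (approx_consistent t) hp); apply/and5P.
Qed.

Lemma words_exist (A : seq nat) j : exists ws : seq (seq nat),
  forall p, size p = j -> all (mem A) p -> p \in ws.
Proof.
elim: j => [|j [ws IH]]; first by exists [:: [::]] => -[].
exists [seq a :: w | a <- A, w <- ws] => -[//|a p] [sp] /andP[aA pA].
by apply/allpairsP; exists (a, p); split=> //; apply: IH.
Qed.

Lemma demand_exists d N : exists2 v, N <= v & demand v = d.
Proof.
pose f j := pickle (d, j : nat).
have f_inj : injective f by move=> i j /(pcan_inj pickleK) [].
have [j Nj] : exists j, N <= f j.
  apply/not_existsP => h.
  have sub : {subset map f (iota 0 N.+1) <= iota 0 N}.
    by move=> _ /mapP[j _ ->]; rewrite mem_iota /= add0n ltnNge; apply/negP.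
  have := uniq_leq_size (_ : uniq (map f (iota 0 N.+1))) sub.
  by rewrite map_inj_uniq // iota_uniq size_map !size_iota ltnn => /(_ isT).
by exists (f j); rewrite // /demand /f pickleK.
Qed.

(** A demand is finite whereas [g] is a function. Only the words over [0 :: map succn F], the names
    of the new point and of [F], matter; [B] bounds their codes, and [L] tabulates [g] up to
    there. *)
Lemma new_point (s : nat) (F : seq nat) (g : colouring) : size F <= k.+2 ->
  exists v, [/\ v \notin F, srt v = s &
    let c p a b := if v \in [:: a, b & p]
      then g (map (shift v) p) (shift v a) (shift v b) else col p a b in
    consistent k srt c (mem (v :: F)) ->
    forall p a b, size p = k -> all (mem (v :: F)) [:: a, b & p] ->
      col p a b = c p a b].
Proof.
move=> sF; have [ws wsP] := words_exist (0 :: map succn F) k.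
have [B hB] : exists B, forall p a b, size p = k ->
    all (mem (0 :: map succn F)) [:: a, b & p] -> pickle (p, a, b) < B.
  pose A := 0 :: map succn F.
  exists (\max_(w <- ws) \max_(a <- A) \max_(b <- A) pickle (w, a, b)).+1.
  move=> p a b sp /and3P[aA bA pA]; rewrite ltnS.
  apply: leq_trans (leq_bigmax_seq _ (wsP _ sp pA) isT).
  by apply: leq_trans (leq_bigmax_seq _ aA isT); apply: leq_bigmax_seq bA isT.
pose L := mkseq (fun c => if @unpickle (seq nat * nat * nat)%type c is Some (p, a, b)
  then g p a b else blank) B.
have [v Fv dv] := demand_exists (s, F, L) (foldr maxn 0 F).+1.
have hF : all (fun q => q < v) F.
  have := leqnn (foldr maxn 0 F); rewrite {1}foldr_maxn_leq => /allP h.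
  by apply/allP => q /h /= qF; apply: leq_ltn_trans qF Fv.
have vF : v \notin F by apply/negP => /(allP hF); rewrite ltnn.
exists v; split=> //; first by rewrite /point_sort dv.
move=> c hc p a b sp hp.
pose e := extend k srt (approx v) v F (demanded v).
have ec p' a' b' : size p' = k -> all (mem (v :: F)) [:: a', b' & p'] ->
    e p' a' b' = c p' a' b'.
  move=> sp' hp'; rewrite /e /extend hp' andbF /given /c.
  case: ifP => [vp|/negbFE vp]; last first.
    rewrite vp hp' /demanded dv /=.
    have sh q : q \in v :: F -> shift v q \in 0 :: map succn F.
      rewrite !inE /shift; case: eqP => //= _ qF.
      by rewrite mem_map // => ? ? [].
    rewrite nth_mkseq ?pickleK //; apply: hB; rewrite ?size_map //=.
    case/and3P: hp' => /sh -> /sh -> /allP hp' /=; apply/allP => _ /mapP[q /hp' qp ->].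
    exact: sh.
  rewrite (negbTE vp) approx_stable //; apply/allP => q qp.
  have := allP hp' _ qp; rewrite /= inE => /orP[/eqP e'|]; last by move/(allP hF).
  by rewrite -e' qp in vp.
have adm : admissible v F e by split=> //; apply: consistent_eq hc.
rewrite -ec // -(@approx_stable v.+1); last first.
  apply/allP => q /(allP hp); rewrite /= inE => /orP[/eqP->//|/(allP hF)].
  exact: ltnW.
by rewrite /= dv /= asboolT.
Qed.

End Model.

(** Partial isomorphism between two tuples, restricted to the positions in [S] and with colours
    compared up to [R]. It is used with equality and with [blur N]. *)
Record agree k n (R : colour -> colour -> Prop) (S : pred 'I_n)
    (s1 : nat -> nat) (c1 : colouring) (f : 'I_n -> nat)
    (s2 : nat -> nat) (c2 : colouring) (h : 'I_n -> nat) : Prop := Agree {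
  agree_srt : forall i, S i -> s1 (f i) = s2 (h i);
  agree_eq : forall i j, S i -> S j -> (f i == f j) = (h i == h j);
  agree_col : forall w a b, size w = k -> S a -> S b -> all S w ->
    R (c1 (map f w) (f a) (f b)) (c2 (map h w) (h a) (h b)) }.

Lemma agree_comp k n m R (S : pred 'I_n) (S' : pred 'I_m) s1 c1 f s2 c2 h
    (t : 'I_m -> 'I_n) :
  (forall i, S' i -> S (t i)) -> @agree k n R S s1 c1 f s2 c2 h ->
  @agree k m R S' s1 c1 (f \o t) s2 c2 (h \o t).
Proof.
move=> hS [hs he hc]; split=> [i /hS/hs //|i j /hS hi /hS hj|w a b sw /hS ha /hS hb hw].
  exact: he.
rewrite (map_comp f t) (map_comp h t); apply: hc => //; first by rewrite size_map.
by apply/allP => _ /mapP[i /(allP hw)/hS hi ->].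
Qed.

Lemma eq_agree k n R (S S' : pred 'I_n) s1 c1 f f' s2 c2 h h' :
  (forall i, S' i -> S i) ->
  (forall i, S' i -> f' i = f i) -> (forall i, S' i -> h' i = h i) ->
  @agree k n R S s1 c1 f s2 c2 h -> @agree k n R S' s1 c1 f' s2 c2 h'.
Proof.
move=> hS hf hh [hs he hc]; split=> [i Si|i j Si Sj|w a b sw Sa Sb Sw].
- by rewrite hf // hh // hs // hS.
- by rewrite !hf // !hh // he // hS.
have -> : map f' w = map f w by apply/eq_in_map => i /(allP Sw)/hf.
have -> : map h' w = map h w by apply/eq_in_map => i /(allP Sw)/hh.
rewrite !hf // !hh //; apply: hc => //; try exact: hS.
by apply/allP => i /(allP Sw)/hS.
Qed.

Definition upd n (f : 'I_n -> nat) (i : 'I_n) u := fun j => if j == i then u else f j.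

Lemma upd_same n f (i : 'I_n) u : upd f i u i = u.
Proof. by rewrite /upd eqxx. Qed.

Lemma upd_other n f (i j : 'I_n) u : j != i -> upd f i u j = f j.
Proof. by rewrite /upd => /negbTE ->. Qed.

Section Tuples.
Variable k : nat.
Local Notation n := k.+3.
(** The sorts of the model are those read off the demands; they do not depend on [k], unlike the
    colours. *)
Local Notation srt := point_sort.
Local Notation col := (edge_colour k).
Implicit Types (f g h : 'I_n -> nat).

Lemma one_point_extension (S : pred 'I_n) g s' c' h i :
  @agree k n eq S srt col g s' c' h -> ~~ S i ->
  consistent k s' c' (mem (codom h)) ->
  exists v, @agree k n eq (fun j => (j == i) || S j) srt col (upd g i v) s' c' h.
Proof.
move=> hag Si hc.
have [/existsP[j /andP[Sj /eqP hj]]|] := boolP [exists j, S j && (h j == h i)].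
  exists (g j).
  apply: (@eq_agree _ _ _ (fun j => (j == i) || S j) _ _ _
    (g \o (fun l => if l == i then j else l)) _ _ _
    (h \o (fun l => if l == i then j else l))) => //.
  - by move=> l _; rewrite /upd /=; case: eqP.
  - by move=> l _ /=; case: eqP => // ->.
  by apply: agree_comp hag => l; case: eqP.
rewrite negb_exists => /forallP new.
(* Since [i] is not in [S], at most [n - 1], that is [k + 2], points are prescribed, which is the
   bound on demands. *)
pose F := [seq g j | j <- enum 'I_n & S j].
have sF : size F <= k.+2.
  have : 0 < count (predC S) (enum 'I_n).
    by rewrite -has_count; apply/hasP; exists i; rewrite ?mem_enum.
  have := count_predC S (enum 'I_n); rewrite size_enum_ord size_map size_filter.
  move: (count S _) (count (predC S) _) => a b ab b0.
  by rewrite -ltnS -ltnS -ab -addn1 leq_add2l.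
have gF j : S j -> g j \in F by move=> Sj; rewrite map_f // mem_filter Sj mem_enum.
(* Names in demands become positions: [0] is the new point, hence [i], and [r.+1] is a position at
   which [g] takes the value [r]. *)
pose pos q := if q is r.+1 then
  (if [pick j | S j && (g j == r)] is Some j then j else i) else i.
pose gg : colouring := fun p a b => c' (map (h \o pos) p) (h (pos a)) (h (pos b)).
have [v [vF sv /= hv]] := new_point (s' (h i)) gg sF.
have gv j : S j -> (g j == v) = false.
  by move=> /gF gj; apply: contraNF vF => /eqP <-.
pose P q := h (pos (shift v q)).
have Pv : P v = h i by rewrite /P /shift eqxx.
have Pg j : S j -> P (g j) = h j.
  move=> Sj; rewrite /P /shift gv //=; case: pickP => [l /andP[Sl /eqP gl]|/(_ j)].
    by apply/eqP; rewrite -(agree_eq hag) // gl.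
  by rewrite Sj eqxx.
have vFP q : q \in v :: F -> q = v \/ exists2 j, S j & q = g j.
  rewrite inE => /orP[/eqP->|/mapP[j]]; first by left.
  by rewrite mem_filter => /andP[Sj _] ->; right; exists j.
have cP p a b : size p = k -> all (mem (v :: F)) [:: a, b & p] ->
   (if v \in [:: a, b & p] then gg (map (shift v) p) (shift v a) (shift v b)
    else col p a b) = c' (map P p) (P a) (P b).
  move=> sp /allP hp; case: ifP => [_|/negbT vp].
    by rewrite /gg /P -map_comp.
  have old q : q \in [:: a, b & p] -> exists2 j, S j & q = g j.
    move=> qp; have [e|//] := vFP q (hp q qp).
    by rewrite -e qp in vp.
  have [ja Sa ea] : exists2 j, S j & a = g j by apply: old; rewrite inE eqxx.
  have [jb Sb eb] : exists2 j, S j & b = g j by apply: old; rewrite !inE eqxx orbT.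
  have [w Sw ew] : exists2 w, all S w & p = map g w.
    have : forall q, q \in p -> exists2 j, S j & q = g j.
      by move=> q qp; apply: old; rewrite !inE qp !orbT.
    elim: (p) => [|q p' IH] hq; first by exists [::].
    have [w Sw ->] : exists2 w, all S w & p' = map g w.
      by apply: IH => r rp; apply: hq; rewrite inE rp orbT.
    have [|j Sj ->] := hq q; first by rewrite inE eqxx.
    by exists (j :: w); rewrite //= Sj.
  rewrite ea eb ew !Pg // -map_comp (@eq_in_map _ _ (P \o g) h w).1; last first.
    by move=> j /(allP Sw) /= Sj; rewrite Pg.
  by apply: (agree_col hag) => //; move: sp; rewrite ew size_map.
have cons : consistent k srt (fun p a b =>
    if v \in [:: a, b & p] then gg (map (shift v) p) (shift v a) (shift v b)
    else col p a b) (mem (v :: F)).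
  apply: (consistent_pullback (P := P) _ cP hc) => q /vFP[->|[j Sj ->]] /=.
    by rewrite Pv codom_f sv.
  by rewrite Pg // codom_f (agree_srt hag).
have Pu j : (j == i) || S j -> P (upd g i v j) = h j.
  by rewrite /upd; case: eqP => [->|_] //=; apply: Pg.
have uF j : (j == i) || S j -> upd g i v j \in v :: F.
  by rewrite /upd; case: eqP => [->|_] /=; rewrite inE ?eqxx // => /gF ->; rewrite orbT.
exists v; split.
- move=> j; rewrite /upd; case: eqP => [->|_] //=.
  exact: agree_srt hag _.
- move=> a b; rewrite /upd; case: eqP => [->|_]; case: eqP => [->|_] /= Sa Sb.
  + by rewrite !eqxx.
  + rewrite eq_sym gv // eq_sym; apply/esym/negbTE.
    by have := new b; rewrite Sb.
  + rewrite gv //; apply/esym/negbTE.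
    by have := new a; rewrite Sa.
  exact: agree_eq hag _ _ Sa Sb.
move=> w a b sw Sa Sb Sw.
have hp : all (mem (v :: F)) [:: upd g i v a, upd g i v b & map (upd g i v) w].
  apply/and3P; split; [exact: uF|exact: uF|].
  by apply/allP => _ /mapP[j /(allP Sw) Sj ->]; apply: uF.
rewrite (hv cons) ?size_map // cP ?size_map // !Pu // -map_comp.
by congr (c' _ _ _); apply/eq_in_map => j /(allP Sw)/Pu.
Qed.

Lemma realize s' c' h : consistent k s' c' (mem (codom h)) ->
  exists g, @agree k n eq predT srt col g s' c' h.
Proof.
move=> hc.
have : forall m, m <= n -> exists g, @agree k n eq (fun j => j < m) srt col g s' c' h.
  elim=> [|m IH] mn; first by exists (fun _ => 0).
  have [g hg] := IH (ltnW mn).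
  have [|v hv] := @one_point_extension _ g s' c' h (Ordinal mn) hg _ hc.
    by rewrite ltnn.
  exists (upd g (Ordinal mn) v); apply: eq_agree hv => // j.
  by rewrite ltnS leq_eqVlt => /orP[/eqP e|->]; rewrite ?orbT // -val_eqE /= e eqxx.
move=> /(_ n (leqnn n)) [g hg]; exists g; apply: eq_agree hg => // j _.
Qed.

End Tuples.

(** * Identifying the ideal red with late copies *)

Definition late (N : nat) (c : colour) :=
  if c is inr r then (if r is Some (_, l) then N <= l else true) else false.

Definition blur N (c c' : colour) : Prop := c = c' \/ (late N c /\ late N c').

Lemma blur_sym N c c' : blur N c c' -> blur N c' c.
Proof. by case=> [->|[]]; [left|right]. Qed.

Lemma blur_trans N c2 c1 c3 : blur N c1 c2 -> blur N c2 c3 -> blur N c1 c3.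
Proof. by case=> [->|[h1 h2]] // [<-|[h3 h4]]; right. Qed.

Lemma late_red N c : late N c -> isred c.
Proof. by case: c. Qed.

Lemma late_mate N c : late N (mate c) = late N c.
Proof. by case: c => // -[[]|]. Qed.

Lemma mateK : involutive mate.
Proof. by case=> // -[[e l]|] //=; rewrite negbK. Qed.

Lemma blur_late N c c' : blur N c c' -> late N c = late N c'.
Proof. by case=> [->|[-> ->]]. Qed.

Lemma blur_red N c c' : blur N c c' -> isred c = isred c'.
Proof. by case=> [->|[/late_red-> /late_red->]]. Qed.

Lemma blur_mark N c c' : blur N c c' -> (c == mark) = (c' == mark).
Proof. by case=> [->//|[]]; case: c => // c _; case: c'. Qed.

Lemma blur_allows N c c' u : blur N c c' -> allows c u = allows c' u.
Proof. by case=> [->//|[]]; case: c => // c _; case: c'. Qed.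

Lemma blur_mono N N' c c' : N <= N' -> blur N' c c' -> blur N c c'.
Proof.
have mono d : N <= N' -> late N' d -> late N d.
  by case: d => // -[[e l]|] //= h /(leq_trans h).
by move=> h [->|[/(mono _ h) ? /(mono _ h) ?]]; [left|right].
Qed.

Lemma consistent_recolour k N srt c1 c2 (G : pred nat) :
  (forall p a b, size p = k -> all G [:: a, b & p] -> blur N (c1 p a b) (c2 p a b)) ->
  consistent k srt c2 G ->
  (forall p c z w, params k srt p -> all G [:: c, z, w & p] ->
    srt c = k.+2 -> k.+2 < srt z -> k.+2 < srt w -> srt z != srt w ->
    isred (c2 p c z) -> isred (c2 p c w) -> isred (c2 p z w) ->
    c2 p c w = mate (c2 p c z) -> c1 p c w = mate (c1 p c z)) ->
  consistent k srt c1 G.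
Proof.
move=> hb C hZ.
have sP p : params k srt p -> size p = k.
  by move=> hp; rewrite -(size_map srt) hp size_iota.
split=> p x z w hp hG.
all: have [/sP sp /and4P[Gx Gz Gw Gp]] := conj hp hG.
all: have B a b : G a -> G b -> blur N (c1 p a b) (c2 p a b).
all: try by move=> Ga Gb; apply: hb; [exact: sP | apply/and3P].
- move=> sx sz sw zw /eqP; rewrite (blur_mark (B _ _ Gx Gz)) => /eqP xz /eqP.
  rewrite (blur_mark (B _ _ Gx Gw)) => /eqP xw.
  rewrite (blur_mark (B _ _ Gz Gw)) (blur_red (B _ _ Gz Gw)).
  exact: (consX C hp hG).
- move=> sx sz sw zw /eqP; rewrite (blur_mark (B _ _ Gx Gz)) => /eqP xz /eqP.
  rewrite (blur_mark (B _ _ Gx Gw)) => /eqP xw.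
  rewrite (blur_mark (B _ _ Gz Gw)).
  exact: (consY C hp hG).
- move=> sx sz sw /eqP; rewrite (blur_mark (B _ _ Gx Gw)) => /eqP xz /eqP.
  rewrite (blur_mark (B _ _ Gz Gw)) => /eqP xw.
  rewrite (blur_allows _ (B _ _ Gx Gz)).
  exact: (consS C hp hG).
move=> sx sz sw zw; rewrite (blur_red (B _ _ Gx Gz)) (blur_red (B _ _ Gx Gw)).
rewrite (blur_red (B _ _ Gz Gw)) => r1 r2 r3.
by apply: hZ => //; apply: (consZ C hp hG).
Qed.

Section Blur.
Variable k : nat.
Local Notation n := k.+3.
Local Notation srt := point_sort.
Local Notation col := (edge_colour k).
Implicit Types (f g h : 'I_n -> nat).

Definition blurred N f g := agree k (blur N) predT srt col f srt col g.

Definition same_type f g := agree k eq predT srt col f srt col g.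

Definition rhofree f := forall (w : seq 'I_n) a b, size w = k ->
  col (map f w) (f a) (f b) != rho.

Lemma codom_full (f : 'I_n -> nat) (s : seq nat) :
  uniq s -> {subset s <= codom f} -> size s <= n.
Proof. by move=> us sub; have := uniq_leq_size us sub; rewrite size_codom card_ord. Qed.

(** Three apexes and the parameters are [k + 3 = n] different points and fill the tuple, so no
    further apex can constrain the reds of such a triangle when an [n]-tuple is recoloured. *)
Lemma triangle_full (f : 'I_n -> nat) p c z w : params k srt p ->
  all (mem (codom f)) [:: c, z, w & p] -> srt c = k.+2 -> k.+2 < srt z ->
  k.+2 < srt w -> srt z != srt w -> {subset codom f <= [:: c, z, w & p]}.
Proof.
move=> pp hG sc sz sw zw q qG; apply: contraT => qn.
have sp : size p = k by rewrite -(size_map srt) pp size_iota.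
have cz : c != z by apply: contraTneq sz => <-; rewrite sc ltnn.
have cw : c != w by apply: contraTneq sw => <-; rewrite sc ltnn.
have zw' : z != w by apply: contraNneq zw => ->.
have U : uniq ([:: c; z; w] ++ p).
  apply: (uniq_points pp); last by rewrite /= !inE !negb_or cz cw zw'.
  by rewrite /= sc (leqW (leqnSn k)) (ltnW (ltnW (ltnW sz))) (ltnW (ltnW (ltnW sw))).
have : size (q :: [:: c; z; w] ++ p) <= n.
  apply: (@codom_full f); first by rewrite cons_uniq qn.
  by move=> r; rewrite inE => /orP[/eqP->//|]; exact: (allP hG).
by rewrite /= sp ltnn.
Qed.

Lemma triangle_only (f : 'I_n -> nat) p c z w q : params k srt p ->
  all (mem (codom f)) [:: c, z, w & p] -> srt c = k.+2 -> k.+2 < srt z ->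
  k.+2 < srt w -> srt z != srt w -> q \in codom f -> k.+2 < srt q ->
  q = z \/ q = w.
Proof.
move=> pp hG sc sz sw zw qG sq.
have := triangle_full pp hG sc sz sw zw qG.
rewrite !inE => /or4P[]/eqP; [|by left|by right|].
  by move=> e; rewrite e sc ltnn in sq.
by move=> /eqP/(params_lt pp); rewrite ltnNge (ltnW (ltnW (ltnW sq))).
Qed.

(** The back-and-forth step, which makes the definable relations closed under cylindrification. The
    tuple [f'] is recoloured so that its old points get the colours of [g], and the new point is
    then realized. The level [N] is kept because late reds at [u] may be chosen afresh. *)
Lemma blurred_forth N f g i u : blurred N f g ->
  exists v, blurred N (upd f i u) (upd g i v).
Proof.
move=> hfg.
have [/existsP[j /eqP fj]|] := boolP [exists j, f j == u].
  exists (g j); have tE e : upd e i (e j) =1 e \o (fun l => if l == i then j else l).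
    by move=> l; rewrite /upd /=; case: eqP.
  apply: (eq_agree (S := predT) _ _ _ (agree_comp _ hfg)) => // l _;
    rewrite -?fj; exact: tE.
rewrite negb_exists => /forallP fu.
set f' := upd f i u.
pose tau q := if [pick j | f j == q] is Some j then g j else 0.
have tauf j : tau (f j) = g j.
  rewrite /tau; case: pickP => [l /eqP fl|/(_ j)]; last by rewrite eqxx.
  by apply/eqP; rewrite -(agree_eq hfg) // fl.
pose cg p a b := col (map tau p) (tau a) (tau b).
(* If the old tuple already contains [f j] with [a], [f j], [u] pairwise joined by
   red, then the colour of [a] and [u] must match the one that [a] and [f j] have
   in [g], which may differ from the one in [f]; otherwise rho will do. *)
pose wit p a : pred 'I_n := fun j => [&& k.+2 < srt (f j), srt (f j) != srt u,
  isred (col p a (f j)), j != i & isred (col p (f j) u) || isred (col p u (f j))].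
pose new p a b := if ~~ late N (col p a b) then col p a b else
  if [&& b == u, k.+2 < srt u, srt a == k.+2 & map srt p == iota 0 k] then
    if [pick j | wit p a j] is Some j then mate (cg p a (f j)) else rho
  else rho.
pose col' p a b := if u \in [:: a, b & p] then new p a b else cg p a b.
have codE q : q \in codom f' -> q = u \/ exists2 j, j != i & q = f j.
  case/codomP => j ->; rewrite /f' /upd; case: eqP => [_|/eqP ji]; first by left.
  by right; exists j.
have oldE (s : seq nat) : {subset s <= codom f'} -> u \notin s ->
    exists2 w, all (predC1 i) w & s = map f w.
  elim: s => [|q s IH] sub us; first by exists [::].
  have [|w hw ->] := IH (fun r rs => sub r (mem_behead (s := q :: s) rs)).
    by apply: contra us => h; rewrite inE h orbT.
  have [e|[j ji ->]] := codE q (sub q (mem_head _ _)).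
    by rewrite e mem_head in us.
  by exists (j :: w); rewrite //= ji.
have cgE p a b : size p = k -> all (mem (codom f')) [:: a, b & p] ->
    u \notin [:: a, b & p] -> blur N (cg p a b) (col p a b).
  move=> sp /allP sub us; have [[|ja [|jb w]] _ //] := oldE _ sub us.
  case=> ea eb ew; rewrite /cg ea eb ew -map_comp !tauf.
  rewrite (@eq_map _ _ (tau \o f) g tauf).
  apply: blur_sym; apply: (agree_col hfg); rewrite ?all_predT //.
  by move: sp; rewrite ew size_map.
have C : full_consistent k srt col predT := col_consistent k.
have GT (s : seq nat) : all predT s by apply/allP.
have notold p a j : map srt p = iota 0 k -> srt a = k.+2 -> k.+2 < srt u ->
    j != i -> [/\ u \notin p, u != a & u != f j].
  move=> pp sa su ji; split; last by rewrite eq_sym fu.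
    by apply/negP => /(params_lt pp); lia.
  by apply: contraTneq su => ->; rewrite sa ltnn.
have newE p a b : size p = k -> all (mem (codom f')) [:: a, b & p] ->
    blur N (new p a b) (col p a b).
  move=> sp /and3P[hA hb hp]; rewrite /new; case: ifPn => [_|]; first by left.
  rewrite negbK => lc; case: ifP => [/and4P[/eqP eb su /eqP sa /eqP pp]|_]; last by right.
  case: pickP => [j /and5P[s1 s2 r1 ji r2]|_]; last by right.
  (* In [f] the mate condition for [a], [f j], [u] relates the colour being replaced to that of [a]
     and [f j], so both are late. *)
  right; split=> //; rewrite late_mate.
  have [up ua uj] := notold _ _ _ pp sa su ji.
  have fjf : f j \in codom f' by rewrite -(upd_other f u ji) codom_f.
  rewrite (blur_late (cgE _ _ _ _ _ _)) //; last 2 first.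
  - exact/and3P.
  - by rewrite !inE !negb_or ua uj up.
  have /orP r2' := r2; have s2' : srt u != srt (f j) by rewrite eq_sym.
  subst b; have ru := late_red lc.
  case: r2' => r2'; last first.
    by rewrite (consZ C pp (GT _) sa su s1 s2' ru r1 r2') late_mate.
  by rewrite (consZ C pp (GT _) sa s1 su s2 r1 ru r2') late_mate in lc.
have col'E p a b : size p = k -> all (mem (codom f')) [:: a, b & p] ->
    blur N (col' p a b) (col p a b).
  by move=> sp hp; rewrite /col'; case: ifPn => [_|]; [exact: newE|exact: cgE].
have ag : agree k eq (predC1 i) srt col g srt col' f'.
  have f'j j : j != i -> f' j = f j by move=> h; rewrite /f' upd_other.
  split=> [j ji|j l ji li|w a b sw ai bi wi].
  - by rewrite f'j // (agree_srt hfg).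
  - by rewrite !f'j // (agree_eq hfg).
  have -> : map f' w = map f w by apply/eq_in_map => j /(allP wi) /f'j.
  rewrite !f'j // /col' ifN.
    rewrite /cg -map_comp !tauf; congr (col _ _ _).
    by apply/esym/eq_map => l /=; rewrite tauf.
  rewrite !inE ![u == _]eq_sym !negb_or !fu /=; apply/mapP => -[j _ e].
  by have := fu j; rewrite e eqxx.
have cons' : consistent k srt col' (mem (codom f')).
  apply: (consistent_recolour col'E); first exact: consistent_sub C.
  move=> p c z w pp hG sc sz sw zw rcz rcw rzw cw.
  have sp : size p = k by rewrite -(size_map srt) pp size_iota.
  have /and4P[cG zG wG pG] := hG.
  have swz : srt w != srt z by rewrite eq_sym.
  have dist : [/\ c != z, c != w & z != w].
    split; first by apply: contraTneq sz => <-; rewrite sc ltnn.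
      by apply: contraTneq sw => <-; rewrite sc ltnn.
    by apply: contraNneq zw => ->.
  have lcw : late N (col p c w) = late N (col p c z) by rewrite cw late_mate.
  have only q := triangle_only pp hG sc sz sw zw (q := q).
  have blank2 a b : u != b ->
      new p a b = if ~~ late N (col p a b) then col p a b else rho.
    by rewrite /new eq_sym => /negbTE ->.
  (* As a parameter or as [c], the point [u] takes part in both reds. They are late together, and
     then both become [rho]. *)
  have [up|up] := boolP (u \in p).
    rewrite /col' !inE up !orbT !blank2 ?lcw; first by case: ifP.
      apply: contraTneq (params_lt pp up) => ->.
      by rewrite -leqNgt (ltnW (ltnW (ltnW sz))).
    apply: contraTneq (params_lt pp up) => ->.
    by rewrite -leqNgt (ltnW (ltnW (ltnW sw))).
  have [uc|uc] := eqVneq u c.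
    subst c; case: dist => uz uw _.
    by rewrite /col' !inE eqxx /= !blank2 // lcw; case: ifP.
  (* Only one of the two reds is new. If it is early, so is the other, which then has not changed
     either; if it is late, the witness picked must be [w], as the triangle fills the tuple. *)
  have [uz|uz] := eqVneq u z.
    subst z; have uw : u != w by case: dist.
    rewrite /col' !inE eqxx (negbTE uc) (negbTE uw) (negbTE up) /=.
    have cgw : blur N (cg p c w) (col p c w).
      apply: cgE; rewrite ?inE ?negb_or ?uc ?uw //; exact/and3P.
    rewrite /new; case: ifPn => [nl|].
      case: cgw => [->//|[_]]; first by rewrite lcw (negbTE nl).
    rewrite negbK => lc; rewrite eqxx sz sc pp !eqxx /=.
    have [e|[jw ji ew]] := codE w wG; first by rewrite e eqxx in uw.
    subst w.
    case: pickP => [l /and5P[l1 l2 l3 li l4]|/(_ jw)].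
      have fl : f l \in codom f' by rewrite -(upd_other f u li) codom_f.
      have [e|->] := only _ fl l1; last by rewrite mateK.
      by rewrite e eqxx in l2.
    by rewrite /wit sw swz rcw ji rzw orbT.
  have [ew|uw] := eqVneq u w; last first.
    have : u \in codom f' by rewrite -(upd_same f i u) codom_f.
    move/(triangle_full pp hG sc sz sw zw).
    by rewrite !inE (negbTE uc) (negbTE uz) (negbTE uw) (negbTE up).
  subst w; rewrite /col' !inE eqxx (negbTE uc) (negbTE uz) (negbTE up) /=.
  have cgz : blur N (cg p c z) (col p c z).
    apply: cgE; rewrite ?inE ?negb_or ?uc ?uz //; exact/and3P.
  rewrite /new; case: ifPn => [nl|].
    by case: cgz => [->//|[_]]; rewrite -lcw (negbTE nl).
  rewrite negbK => lc; rewrite eqxx sw sc pp !eqxx /=.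
  have [e|[jz ji ez]] := codE z zG; first by rewrite e eqxx in uz.
  subst z.
  case: pickP => [l /and5P[l1 l2 l3 li l4]|/(_ jz)].
    have fl : f l \in codom f' by rewrite -(upd_other f u li) codom_f.
    have [->//|e] := only _ fl l1.
    by rewrite e eqxx in l2.
  by rewrite /wit sz zw rcz ji rzw.
have nii : ~~ predC1 i i by rewrite /= eqxx.
have [v hv] := one_point_extension ag nii cons'.
have hv' : agree k eq predT srt col (upd g i v) srt col' f'.
  by apply: eq_agree hv => // j _; rewrite /= orbN.
exists v; split=> [j _|j l _ _|w a b sw _ _ _].
- by rewrite (agree_srt hv').
- by rewrite (agree_eq hv').
rewrite (agree_col hv') ?all_predT //; apply/blur_sym/col'E; rewrite ?size_map //.
by rewrite /= !codom_f; apply/allP => _ /mapP[j _ ->]; exact: codom_f.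
Qed.

End Blur.

Section Realization.
Variable k : nat.
Local Notation n := k.+3.
Local Notation srt := point_sort.
Local Notation col := (edge_colour k).
Implicit Types (f g h : 'I_n -> nat).

Lemma rhofree_dense N f : exists g, blurred N f g /\ rhofree g.
Proof.
(* Among n points there are at most two apexes besides one of sort [k.+2]; give
   their reds the two different classes. *)
pose hb b := [exists j, k.+2 < srt (f j) < srt b].
pose c' p a b : colour := if col p a b == rho then inr (Some (hb b, N)) else col p a b.
have cE p a b : blur N (c' p a b) (col p a b).
  by rewrite /c'; case: eqP => [->|_]; [right; rewrite /= leqnn|left].
have C : full_consistent k srt col predT := col_consistent k.
have hc : consistent k srt c' (mem (codom f)).
  apply: (consistent_recolour (fun p a b _ _ => cE p a b)).
    exact: consistent_sub C.
  move=> p c z w pp hG sc sz sw zw _ _ _ cw.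
  rewrite /c'; have [cz|/eqP ncz] := eqVneq (col p c z) rho; last first.
    rewrite cw ifN //; apply/eqP => e; case: ncz.
    by rewrite -[LHS]mateK e.
  rewrite cw cz !eqxx /=; congr (inr (Some (_, N))).
  have only q := triangle_only pp hG sc sz sw zw (q := q).
  have [_ /and4P[_ zG wG _]] := conj I hG.
  have [/codomP[jz ez] /codomP[jw ew]] := conj zG wG.
  case: (ltngtP (srt z) (srt w)) zw => // lt _.
    have -> : hb w by apply/existsP; exists jz; rewrite -ez sz.
    apply/esym/existsP => -[j /andP[j1 j2]].
    have [e|e] := only _ (codom_f f j) j1; first by rewrite e ltnn in j2.
    by have := ltn_trans j2 lt; rewrite e ltnn.
  have -> : hb z by apply/existsP; exists jw; rewrite -ew sw.
  apply/negbTE/existsP => -[j /andP[j1 j2]].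
  have [e|e] := only _ (codom_f f j) j1; last by rewrite e ltnn in j2.
  by have := ltn_trans j2 lt; rewrite e ltnn.
have [g hg] := realize hc; exists g; split.
  split=> [i _|i j _ _|w a b sw _ _ _].
  - by rewrite (agree_srt hg).
  - by rewrite (agree_eq hg).
  by rewrite (agree_col hg) ?all_predT //; apply: blur_sym.
move=> w a b sw; rewrite (agree_col hg) ?all_predT // /c'.
by case: ifPn.
Qed.

(** Finitely many reds occur in the tuple, each in a numbered copy, and beyond the largest number
    blurring affects none of them. A tuple with [rho] has no such bound, by [rhofree_dense]. *)
Lemma rhofree_bound f : rhofree f ->
  exists N, forall g, blurred N f g -> same_type f g.
Proof.
move=> hf.
pose lev (c : colour) := if c is inr (Some (_, l)) then l.+1 else 0.
have [ws wsP] := words_exist (codom f) k.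
pose N := \max_(w <- ws) \max_(a <- codom f) \max_(b <- codom f) lev (col w a b).
exists N => g hg; split=> [i _|i j _ _|w a b sw _ _ _].
- by rewrite (agree_srt hg).
- by rewrite (agree_eq hg).
have : blur N (col (map f w) (f a) (f b)) (col (map g w) (g a) (g b)).
  by apply: (agree_col hg); rewrite ?all_predT.
case=> [//|[]].
have le : lev (col (map f w) (f a) (f b)) <= N.
  have pw : map f w \in ws.
    by apply: wsP; rewrite ?size_map //; apply/allP => _ /mapP[j _ ->]; apply: codom_f.
  apply: leq_trans (leq_bigmax_seq _ pw isT).
  apply: leq_trans (leq_bigmax_seq _ (codom_f f a) isT).
  exact: leq_bigmax_seq (codom_f f b) isT.
have := hf w a b sw; move: le; case: col => // -[[e l]|] //=.
by move=> h _ /(leq_ltn_trans)/(_ h); rewrite ltnn.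
Qed.

Definition ppos : seq 'I_n := [seq inord i | i <- iota 0 k].
Definition xpos : 'I_n := inord k.
Definition ypos : 'I_n := inord k.+1.
Definition zpos : 'I_n := ord_max.

(** The four sorts are the distinguished one, [k.+2], and three others, as many as a pigeonhole
    argument with two classes requires. *)
Definition base_colour : colour := inl (iota k.+2 4).

(** With a single apex all conditions on apexes of different sorts are vacuous; only the admission
    of its sort by the base remains. *)
Lemma star_consistent (s : nat -> nat) c h :
  (forall i : 'I_n, i != zpos -> s (h i) = i) -> k.+2 <= s (h zpos) ->
  allows (c (map h ppos) (h xpos) (h ypos)) (s (h zpos)) ->
  consistent k s c (mem (codom h)).
Proof.
move=> hs hz hall.
have hlow q : q \in codom h -> s q < k.+2 -> q = h (inord (s q)).
  case/codomP => i ->; have [->|ni] := eqVneq i zpos; first by rewrite ltnNge hz.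
  by rewrite hs // inord_val.
have hhigh q : q \in codom h -> k.+2 <= s q -> q = h zpos.
  case/codomP => i ->; have [->//|ni] := eqVneq i zpos.
  rewrite hs //; move: ni (ltn_ord i); rewrite -val_eqE /=; lia.
split=> p x z w hp /and4P[xG zG wG pG] sx sz.
- move=> sw /eqP[]; rewrite (hhigh _ zG sz) (hhigh _ wG sw) //.
- move=> sw /eqP[]; rewrite (hhigh _ zG sz) (hhigh _ wG sw) //.
- move=> sw _ _; rewrite (hhigh _ wG sw).
  suff -> : p = map h ppos.
    have := hlow _ xG; rewrite sx => /(_ (ltnW (ltnSn _))) ->.
    by have := hlow _ zG; rewrite sz => /(_ (ltnSn _)) ->.
  rewrite -map_comp -hp -map_comp -[LHS]map_id; apply/eq_in_map => q qp /=.
  apply: hlow; first exact: (allP pG).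
  exact: leq_trans (params_lt hp qp) (leqW (leqnSn k)).
move=> sw /eqP[]; rewrite (hhigh _ zG (ltnW sz)) (hhigh _ wG (ltnW sw)) //.
Qed.

Lemma pposE (i : 'I_n) : (i \in ppos) = (i < k).
Proof.
apply/mapP/idP => [[j]|ik].
  rewrite mem_iota add0n /= => jk ->; rewrite inordK //; lia.
by exists (val i); rewrite ?mem_iota ?inord_val.
Qed.

Lemma size_ppos : size ppos = k.
Proof. by rewrite size_map size_iota. Qed.

(** A fresh name [u0] describes the apex in a finite structure, and [u] realizes it. All colours at
    [u0] are white, which keeps the tuple free of [rho]; cylindrification in the complex algebra
    needs such witnesses. *)
Lemma apex_exists f t : (forall i : 'I_n, i != zpos -> srt (f i) = i) ->
  k.+2 <= t -> allows (col (map f ppos) (f xpos) (f ypos)) t -> rhofree f ->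
  exists u, [/\ srt u = t, col (map f ppos) (f xpos) u = mark,
    col (map f ppos) (f ypos) u = mark & rhofree (upd f zpos u)].
Proof.
move=> hs ht hall hf.
pose u0 := (foldr maxn 0 (codom f)).+1.
have fu j : f j != u0.
  rewrite neq_ltn; apply/orP; left; rewrite ltnS.
  have := leqnn (foldr maxn 0 (codom f)).
  by rewrite {1}foldr_maxn_leq => /allP; apply; apply: codom_f.
pose h := upd f zpos u0.
pose s' q := if q == u0 then t else srt q.
pose c' p a b := if u0 \in [:: a, b & p] then
  if (b == u0) && ((a == f xpos) || (a == f ypos)) then mark else blank
  else col p a b.
have [xz yz] : xpos != zpos /\ ypos != zpos.
  by split; rewrite -val_eqE /= inordK //; lia.
have [hx hy hz] : [/\ h xpos = f xpos, h ypos = f ypos & h zpos = u0].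
  by rewrite /h (upd_other _ _ xz) (upd_other _ _ yz) upd_same.
have pz : map h ppos = map f ppos.
  apply/eq_in_map => i; rewrite pposE => ik; rewrite /h upd_other //.
  by rewrite -val_eqE /=; lia.
have old p a b : all (predC1 zpos) p -> a != zpos -> b != zpos ->
    u0 \notin [:: f a, f b & map f p].
  move=> hp az bz; rewrite !inE !negb_or ![u0 == _]eq_sym !fu /=.
  by apply/mapP => -[j _ /eqP]; rewrite eq_sym (negbTE (fu j)).
have pN : all (predC1 zpos) ppos.
  by apply/allP => i; rewrite pposE /= -val_eqE /=; lia.
have hc : consistent k s' c' (mem (codom h)).
  apply: star_consistent.
  - by move=> i iz; rewrite /h upd_other // /s' (negbTE (fu i)) hs.
  - by rewrite /h upd_same /s' eqxx.
  rewrite pz hx hy hz /s' eqxx /c' ifN //.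
  exact: old.
have ag : agree k eq (predC1 zpos) srt col f s' c' h.
  split=> [i /= iz|i j /= iz jz|w a b sw /= az bz wz].
  - by rewrite /h upd_other // /s' (negbTE (fu i)).
  - by rewrite /h !upd_other.
  have -> : map h w = map f w.
    by apply/eq_in_map => i /(allP wz) /= iz; rewrite /h upd_other.
  by rewrite /h !upd_other // /c' ifN // old.
have nzz : ~~ predC1 zpos zpos by rewrite /= eqxx.
have [u hu'] := one_point_extension ag nzz hc.
have hu : agree k eq predT srt col (upd f zpos u) s' c' h.
  by apply: eq_agree hu' => // j _; rewrite /= orbN.
have pu : map (upd f zpos u) ppos = map f ppos.
  by apply/eq_in_map => i /(allP pN) /= iz; rewrite upd_other.
have E a := agree_col hu (a := a) (b := zpos) size_ppos isT isT (all_predT _).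
exists u; split.
- by have := agree_srt hu (i := zpos) isT; rewrite upd_same /h upd_same /s' eqxx.
- have := E xpos; rewrite pu pz upd_same (upd_other _ _ xz) hx hz => ->.
  by rewrite /c' !inE !eqxx orbT.
- have := E ypos; rewrite pu pz upd_same (upd_other _ _ yz) hy hz => ->.
  by rewrite /c' !inE !eqxx !orbT.
move=> w a b sw; rewrite (agree_col hu) ?all_predT // /c'; case: ifPn => [_|].
  by case: ifP.
move=> nu; have ne j : h j != u0 -> h j = f j.
  by rewrite /h /upd; case: (j == zpos); rewrite ?eqxx.
move: nu; rewrite !inE !negb_or ![u0 == _]eq_sym => /and3P[na nb nw].
rewrite (ne a na) (ne b nb); have -> : map h w = map f w; last exact: hf.
apply/eq_in_map => j jw; apply: ne; apply: contraNneq nw => <-; exact: map_f.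
Qed.

Lemma base_exists : exists f, [/\ forall i : 'I_n, i != zpos -> srt (f i) = i,
  k.+2 <= srt (f zpos), col (map f ppos) (f xpos) (f ypos) = base_colour & rhofree f].
Proof.
pose h (i : 'I_n) := val i; pose s' (q : nat) := q.
pose c' (p : seq nat) a b := if (a == k) && (b == k.+1) then base_colour else blank.
have E : c' (map h ppos) (h xpos) (h ypos) = base_colour.
  by rewrite /c' /h /= !inordK ?eqxx //; lia.
have hc : consistent k s' c' (mem (codom h)).
  apply: star_consistent => //.
  by rewrite E /= !inE eqxx.
have [g hg] := realize hc; exists g; split.
- by move=> i _; rewrite (agree_srt hg).
- by rewrite (agree_srt hg).
- by rewrite (agree_col hg) ?all_predT // size_ppos.
by move=> w a b sw; rewrite (agree_col hg) ?all_predT // /c'; case: ifP.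
Qed.

End Realization.

Import Order.Theory.
Local Open Scope classical_set_scope.
Local Open Scope order_scope.

(** * Consequences of the axioms *)

(** For cylindric algebras this is the usual term; the case [i == j] is separated because that term
    would give [c_i x] there instead of [x]. *)
Definition replacement (K : kind) (I : eqType) : forall A : alg K I, I -> I -> A -> A :=
  match K return forall A : alg K I, I -> I -> A -> A with
  | Sc => fun A i j => @unop _ _ A (Defs.Sub (K:=Sc) isT i j)
  | CA => fun A i j x => if i == j then x
      else @unop _ _ A (Cyl i) (const A (Diag (K:=CA) isT i j) `&` x)
  | QA => fun A i j => @unop _ _ A (Defs.Sub (K:=QA) isT i j)
  | QEA => fun A i j => @unop _ _ A (Defs.Sub (K:=QEA) isT i j)
  end.

Section Laws.
Variables (d : Order.disp_t) (B : ctbDistrLatticeType d) (I : eqType).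
Implicit Types (x y : B) (i j k l : I).

(** The substitution calculus common to the four axiom systems. Laws on composed replacements are
    restricted to elements closed in the target dimensions; this is what the transposition axioms
    and the diagonal term deliver, and the targets used later are free. *)
Record replacement_laws (c : I -> B -> B) (s : I -> I -> B -> B) : Prop :=
  ReplacementLaws {
  rl_c0 : forall i, c i \bot = \bot;
  rl_ext : forall i x, x <= c i x;
  rl_cI : forall i x y, c i y = y -> c i (x `&` y) = c i x `&` y;
  rl_endo : forall i j, bool_endo (s i j);
  rl_id : forall i j x, c i x = x -> s i j x = x;
  rl_cs : forall i j x, i != j -> c i (s i j x) = s i j x;
  rl_ck : forall i j k x, k != i -> k != j -> c k x = x -> c k (s i j x) = s i j x;
  rl_back : forall i j x, i != j -> c j x = x -> s j i (s i j x) = x;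
  rl_chain : forall i j l x, uniq [:: i; j; l] -> c j x = x -> c l x = x ->
    s j l (s i j x) = s i l x;
  rl_comm : forall i j k l x, uniq [:: i; j; k; l] -> c j x = x -> c l x = x ->
    s i j (s k l x) = s k l (s i j x) }.

Section Cylindrification.
Variable c : I -> B -> B.
Hypothesis c0 : forall i, c i \bot = \bot.
Hypothesis cext : forall i x, x <= c i x.
Hypothesis cI : forall i x y, c i (x `&` c i y) = c i x `&` c i y.

Lemma cyl_top i : c i \top = \top.
Proof. by apply/eqP; rewrite -le1x. Qed.

Lemma cyl_idem i x : c i (c i x) = c i x.
Proof. by rewrite -{1}[c i x]meet1x cI cyl_top meet1x. Qed.

Lemma cyl_closedI i x y : c i y = y -> c i (x `&` y) = c i x `&` y.
Proof. by move=> <-; rewrite cI. Qed.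

Lemma cyl_mono i x y : x <= y -> c i x <= c i y.
Proof.
move=> xy; apply/meet_idPl; rewrite -cI; congr (c i _).
exact/meet_idPl/(le_trans xy).
Qed.

Lemma cyl_closedC i x : c i x = x -> c i (~` x) = ~` x.
Proof.
move=> cx; apply/eqP; rewrite eq_le cext andbT -disj_leC.
by rewrite -(cyl_closedI _ cx) meetC meetxC c0.
Qed.

Lemma cyl_closedU i x y : c i x = x -> c i y = y -> c i (x `|` y) = x `|` y.
Proof.
move=> cx cy; rewrite -[x `|` y]complK complU; apply: cyl_closedC.
by rewrite cyl_closedI cyl_closedC.
Qed.

Lemma cylU i x y : c i (x `|` y) = c i x `|` c i y.
Proof.
apply/eqP; rewrite eq_le; apply/andP; split; last first.
  by rewrite leUx !cyl_mono ?leUl ?leUr.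
rewrite -[leRHS](@cyl_closedU i) ?cyl_idem //; apply: cyl_mono.
by rewrite leU2.
Qed.

End Cylindrification.

Lemma endo_compl_meet (f : B -> B) x y : bool_endo f -> f (x `&` y) = f x `&` f y.
Proof.
move=> [fU fC]; apply: compl_inj.
by rewrite -fC !complI fU !fC.
Qed.

Lemma endo_bot (f : B -> B) : bool_endo f -> f \bot = \bot.
Proof. by move=> h; rewrite -(meetxC \top) endo_compl_meet // h.2 !meetxC. Qed.

Lemma endo_mono (f : B -> B) x y : bool_endo f -> x <= y -> f x <= f y.
Proof.
by move=> h /meet_idPl xy; apply/meet_idPl; rewrite -endo_compl_meet // xy.
Qed.

(** Moving back and chaining are instances of Pinter's last equation, after which a replacement
    meets an element closed in the replaced dimension and disappears. *)
Lemma Sc_laws (c : I -> B -> B) s : Sc_eqs c s -> replacement_laws c s.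
Proof.
move=> [c0 [cext [cI [cC [s1 [se [sc [cs [sck [_ [scomm sch]]]]]]]]]]].
split=> //.
- by move=> i x y cy; apply: cyl_closedI.
- by move=> i j x <-; rewrite sc.
- by move=> i j k x ki kj ck; rewrite -sck // ck.
- move=> i j x ij cx; rewrite sch s1 -cx; exact: sc.
- move=> i j l x; rewrite /= !inE !negb_or andbT => /andP[/andP[ij il] jl] cj cl.
  have cs' : c j (s i l x) = s i l x by rewrite -sck ?cj // eq_sym.
  by rewrite sch -{1}cs' sc cs'.
- by move=> i j k l x u _ _; apply: scomm.
Qed.

Lemma QA_laws (c : I -> B -> B) s p (a b : I) : a != b ->
  QA_eqs c s p -> replacement_laws c s.
Proof.
move=> ab [s1 [p1 [pC [cext [cU [sc [cs [sck [se [pe [pp [p3 ps]]]]]]]]]]]].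
have other i : exists j, i != j.
  by have [->|ia] := eqVneq i a; [exists b | exists a].
(* For [j] different from [i], the elements closed under [c i] are the fixed points of the
   endomorphism [s i j]. This gives normality and closure under complements. *)
have c0 i : c i \bot = \bot.
  by have [j ij] := other i; have := cs i j \bot ij; rewrite endo_bot.
have closedC i x : c i x = x -> c i (~` x) = ~` x.
  have [j ij] := other i; move=> cx.
  have sx : s i j x = x by rewrite -cx sc.
  by rewrite -{1}sx -(se i j).2 cs // (se i j).2 sx.
have mono i x y : x <= y -> c i x <= c i y.
  by move=> /join_idPl xy; apply/join_idPl; rewrite -cU xy.
have cI i x y : c i y = y -> c i (x `&` y) = c i x `&` y.
  move=> cy; apply/eqP; rewrite eq_le lexI mono ?leIl //= -{2}cy mono ?leIr //=.
  have xy : x <= (x `&` y) `|` ~` y by rewrite joinIl joinxC meetx1 leUl.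
  apply: le_trans (leI2 (mono i _ _ xy) (lexx y)) _.
  by rewrite cU (closedC i y cy) meetUl meetCx joinx0 leIl.
(* The rest follows from the transposition axioms, since s^i_j and p_ij agree on
   the elements closed under c_j. *)
have sp i j x : c j x = x -> s i j x = p i j x.
  by move=> cx; have sx : s j i x = x by [rewrite -cx sc]; rewrite -(ps j i) sx pC.
split=> //.
- by move=> i j x cx; rewrite -cx sc.
- by move=> i j k x ki kj ck; rewrite -sck // ck.
- move=> i j x ij cx; rewrite (sp i j) // (sp j i).
  + by rewrite pC pp.
  + by rewrite -sp // cs.
- move=> i j l x; rewrite /= !inE !negb_or andbT => /andP[/andP[ij il] jl] cj cl.
  have cl' : c l (s i j x) = s i j x by rewrite -sck ?cl // eq_sym.
  rewrite (sp j l) // (sp i j) // (sp i l) // (pC i j) p3; last first.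
    by rewrite /= !inE !negb_or jl ![_ == i]eq_sym ij il.
  have sx : s j l x = x by rewrite -cj sc.
  by rewrite -(sp j l x cl) sx pC.
- have conj i j k x : uniq [:: i; j; k] -> p i j (p i k (p i j x)) = p j k x.
    by move=> u; rewrite p3 // pp.
  move=> i j k l x u cj cl; have := u; rewrite /= !inE !negb_or !andbT.
  move=> /and3P[/and3P[ij ik il] /andP[jk jl] kl].
  (* Disjoint transpositions commute: write (k l) as (j k)(j l)(j k) and obtain each factor from one
     that moves [i] by conjugation with (i j). *)
  have comm y : p i j (p k l y) = p k l (p i j y).
    have E1 z : p j k z = p i j (p i k (p i j z)).
      by rewrite conj //= !inE !negb_or ij ik jk.
    have E2 z : p j l z = p i j (p i l (p i j z)).
      by rewrite conj //= !inE !negb_or ij il jl.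
    have E3 : p k l y = p j k (p j l (p j k y)).
      by rewrite conj //= !inE !negb_or jk jl kl.
    have E4 z : p i k (p i l (p i k z)) = p k l z.
      by rewrite conj //= !inE !negb_or ik il kl.
    have E : p k l y = p i j (p k l (p i j y)) by rewrite {1}E3 !E1 E2 !pp E4.
    by rewrite E pp.
  have cj' : c j (s k l x) = s k l x by rewrite -sck ?cj.
  have cl' : c l (s i j x) = s i j x by rewrite -sck ?cl // eq_sym.
  by rewrite (sp i j) // (sp k l x) // comm (sp k l) // sp.
Qed.


Lemma CA_laws (c : I -> B -> B) dg : CA_eqs c dg ->
  replacement_laws c (fun i j x => if i == j then x else c i (dg i j `&` x)).
Proof.
move=> [c0 [cext [cI [cC [d1 [d3 c7]]]]]].
have closedI i x y : c i y = y -> c i (x `&` y) = c i x `&` y by apply: cyl_closedI.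
have closedII i x y : c i x = x -> c i y = y -> c i (x `&` y) = x `&` y.
  by move=> cx cy; rewrite closedI ?cx.
have cd i j : i != j -> c i (dg i j) = \top.
  by move=> ij; apply/eqP; rewrite -le1x -(d1 j) (d3 i j j) // cyl_mono ?leIr.
(* (C7) is applied to [dg j i]: its first factor is then [dg j j], the top element, so the second
   vanishes. *)
have dle i j : i != j -> dg i j <= dg j i.
  move=> ij; have := c7 i j (dg j i) ij.
  rewrite (meetC (dg i j)) -(d3 i j j) // d1 meet1x => e.
  by rewrite -[leRHS]complK -disj_leC -lex0 -e.
have dsym i j : dg i j = dg j i.
  by have [->//|ij] := eqVneq i j; apply/eqP; rewrite eq_le !dle // eq_sym.
have dk i j k : k != i -> k != j -> c k (dg i j) = dg i j.
  by move=> ki kj; rewrite (d3 k) // cyl_idem.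
(* On the diagonal an element is recovered from its cylinder, since (C7) separates the cylinders of
   its part and of the complementary part. *)
have back i j x : i != j -> dg i j `&` c i (dg i j `&` x) = dg i j `&` x.
  move=> ij; apply/eqP; rewrite eq_le; apply/andP; split; last by rewrite lexI leIl cext.
  rewrite lexI leIl /= -[leRHS]complK -disj_leC -lex0 -(c7 i j x ij) lexI.
  by rewrite leIxl ?leIr //= (le_trans _ (cext i _)) // leI2 ?leIl.
have sE i j x : i != j -> (if i == j then x else c i (dg i j `&` x)) = c i (dg i j `&` x).
  by move=> /negbTE ->.
split=> //.
- move=> i j; have [_|ij] := eqVneq i j; first by split.
  split=> [x y|x]; first by rewrite meetUr (cylU c0 cext cI).
  apply/eqP; rewrite eq_le -disj_leC meetC c7 // eqxx /=.
  rewrite -[leRHS]complK -disj_leC -complU -(cylU c0 cext cI) -meetUr joinxC.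
  by rewrite meetx1 cd // compl1.
- move=> i j x cx; have [//|ij] := eqVneq i j.
  by rewrite closedI // cd // meet1x.
- by move=> i j x ij; rewrite sE // cyl_idem.
- move=> i j k x ki kj ck; case: eqP => // _.
  by rewrite cC closedII // dk.
- move=> i j x ij cx; rewrite (sE i j) // (sE j i) 1?eq_sym //.
  by rewrite (dsym j i) back // closedI // dsym cd ?meet1x // eq_sym.
- move=> i j l x; rewrite /= !inE !negb_or andbT => /andP[/andP[ij il] jl] cj cl.
  rewrite !sE //.
  have di : c i (dg j l) = dg j l by rewrite dk.
  by rewrite meetC -closedI // cC meetAC closedI // -(d3 j) // eq_sym.
move=> i j k l x; rewrite /= !inE !negb_or !andbT.
move=> /and3P[/and3P[ij ik il] /andP[jk jl] kl] cj cl.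
rewrite !sE //.
have d1' : c i (dg k l) = dg k l by rewrite dk.
have d2' : c k (dg i j) = dg i j by rewrite dk // eq_sym.
rewrite (meetC _ (c k _)) (meetC _ (c i _)) -!closedI // cC.
by rewrite (meetC (dg k l)) (meetC _ (dg i j)) meetA.
Qed.

End Laws.

Lemma variety_laws K (I : eqType) (A : alg K I) (a b : I) : a != b ->
  variety A -> replacement_laws (fun i => @unop _ _ A (Cyl i)) (@replacement K I A).
Proof.
case: K A => A ab /=.
- exact: Sc_laws.
- exact: CA_laws.
- exact: QA_laws ab.
by case=> h _; apply: QA_laws ab h.
Qed.

Lemma replacement_hom K (I : eqType) (A B : alg K I) (f : A -> B) i j x :
  hom f -> f (replacement i j x) = replacement i j (f x).
Proof.
case: K A B f x => A B f x [_ [_ [_ [fI [_ [fo fd]]]]]] /=; try exact: fo.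
by case: eqP => // _; rewrite fo fI fd.
Qed.

Lemma replacement_reduct K (I J : eqType) (e : I -> J) (B : alg K J) i j (x : B) :
  injective e -> @replacement K I (reduct e B) i j x = @replacement K J B (e i) (e j) x.
Proof. by case: K B x => B x ei //=; rewrite (inj_eq ei). Qed.

(** * The pigeonhole argument with three spare dimensions *)

Section Core.
Variables (d : Order.disp_t) (B : ctbDistrLatticeType d) (J : eqType).
Variables (c : J -> B -> B) (s : J -> J -> B -> B).
Hypothesis laws : replacement_laws c s.
Variables (w1 w2 w3 : J) (v : nat -> J).
Hypothesis dims : uniq [:: w1; w2; w3; v 1; v 2; v 3].
Let W := [:: w1; w2; w3].

(** [X i j] behaves like a binary relation between the dimensions [i] and [j]: it is independent of
    the other dimensions listed, and replacement renames its arguments. The parameters stay fixed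
    and are not mentioned. *)
Definition cell_like (X : J -> J -> B) :=
  (forall i j l, i \in W -> j \in W -> l \in W ++ [:: v 1; v 2; v 3] ->
     uniq [:: i; j; l] -> c l (X i j) = X i j) /\
  (forall i j l, i \in W -> j \in W -> l \in W -> uniq [:: i; j; l] ->
     s i l (X i j) = X l j /\ s j l (X i j) = X i l).

(* The base lies in dimensions [w1], [w2]; the apex of the distinguished sort stays
   in [w3], and those of the three other sorts are moved from [w3] to [v 1], [v 2],
   [v 3]. *)
Variables (al be : nat -> J -> J -> B) (n1 n2 red : nat -> nat -> J -> J -> B)
  (cl : bool -> nat -> nat -> J -> J -> B) (P : nat -> B) (base : B).
Hypothesis alC : forall t, cell_like (al t).
Hypothesis beC : forall t, cell_like (be t).
Hypothesis n2C : forall t u, cell_like (n2 t u).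
Hypothesis redC : forall t u, cell_like (red t u).
Hypothesis clC : forall e t u, cell_like (cl e t u).
Hypothesis P_closed : forall t l, l \in [:: v 1; v 2; v 3] -> c l (P t) = P t.
Hypothesis P_base : forall t, (t < 4)%N -> c w3 (P t) = base.
Hypothesis base_closed : c w3 base = base.
Hypothesis P_al : forall t, P t <= al t w1 w3.
Hypothesis P_be : forall t, P t <= be t w2 w3.
Hypothesis al_n1 : forall t u i j, (t < u)%N -> i \in W -> j \in W ->
  uniq [:: w1; i; j] -> al t w1 i `&` al u w1 j <= n1 t u i j.
Hypothesis be_n2 : forall t u i j, (t < u)%N -> i \in W -> j \in W ->
  uniq [:: w2; i; j] -> be t w2 i `&` be u w2 j <= n2 t u i j.
Hypothesis n1_n2 : forall t u i j, i \in W -> j \in W -> i != j ->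
  n1 t u i j `&` n2 t u i j <= red t u i j.
Hypothesis red_cl : forall t i j, i \in W -> j \in W -> i != j ->
  red 0 t i j <= cl false 0 t i j `|` cl true 0 t i j.
Hypothesis cl_red : forall e t u, (0 < t < u)%N ->
  red t u w1 w2 `&` (cl e 0 t w3 w1 `&` cl e 0 u w3 w2) <= \bot.

Let V t : (0 < t < 4)%N -> v t \in [:: v 1; v 2; v 3].
Proof. by case: t => [|[|[|[|t]]]] // _; rewrite !inE eqxx ?orbT. Qed.

Let WV t i : (0 < t < 4)%N -> i \in W -> i != v t.
Proof.
move: dims; rewrite -[X in uniq X]/(W ++ [:: v 1; v 2; v 3]) cat_uniq.
case/and3P => _ /hasPn h _ /V /h vW iW.
by apply: contraTneq iW => ->.
Qed.

Let VV t u : (0 < t < u)%N -> (u < 4)%N -> v t != v u.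
Proof.
have : uniq [:: v 1; v 2; v 3].
  by move: dims; rewrite -[X in uniq X]/(W ++ [:: v 1; v 2; v 3]) cat_uniq => /and3P[].
rewrite /= !inE negb_or andbT => /andP[/andP[v12 v13] v23].
by case: t u => [|[|[|[|t]]]] // [|[|[|[|u]]]].
Qed.

Let W1 : w1 \in W. Proof. by rewrite inE eqxx. Qed.
Let W2 : w2 \in W. Proof. by rewrite !inE eqxx orbT. Qed.
Let W3 : w3 \in W. Proof. by rewrite !inE eqxx !orbT. Qed.
Let w12 : w1 != w2.
Proof. by move: dims => /= /andP[]; rewrite !inE !negb_or => /and5P[]. Qed.
Let w13 : w1 != w3.
Proof. by move: dims => /= /andP[]; rewrite !inE !negb_or => /and5P[]. Qed.
Let w23 : w2 != w3.
Proof. by move: dims => /= /and3P[_]; rewrite !inE !negb_or => /and4P[]. Qed.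

Let sI i j x y : s i j (x `&` y) = s i j x `&` s i j y.
Proof. exact: endo_compl_meet (rl_endo laws i j). Qed.

Let s_mono i j x y : x <= y -> s i j x <= s i j y.
Proof. exact: endo_mono (rl_endo laws i j). Qed.

Let closedI i x y : c i x = x -> c i y = y -> c i (x `&` y) = x `&` y.
Proof. by move=> cx cy; rewrite (rl_cI laws) // cx. Qed.

(** By [rl_chain], the dimension of [W] from which an argument is moved to [v t] does not matter. So
    relations obtained at different places of [W] can be compared. *)
Lemma moved2 X t i j l : cell_like X -> (0 < t < 4)%N -> i \in W -> j \in W ->
  l \in W -> uniq [:: i; j; l] -> s l (v t) (X i l) = s j (v t) (X i j).
Proof.
move=> [Xc Xs] ht iW jW lW u; have [_ <-] := Xs i j l iW jW lW u.
have := u; rewrite /= !inE !negb_or andbT => /andP[/andP[ij il] jl].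
apply: (rl_chain laws).
- by rewrite /= !inE !negb_or jl !(WV ht).
- by apply: Xc => //; rewrite mem_cat lW.
by apply: Xc; rewrite ?mem_cat ?V ?orbT // /= !inE !negb_or ij !(WV ht).
Qed.

Lemma moved1 X t i j l : cell_like X -> (0 < t < 4)%N -> i \in W -> j \in W ->
  l \in W -> uniq [:: i; j; l] -> s l (v t) (X l j) = s i (v t) (X i j).
Proof.
move=> [Xc Xs] ht iW jW lW u; have [<- _] := Xs i j l iW jW lW u.
have := u; rewrite /= !inE !negb_or andbT => /andP[/andP[ij il] jl].
apply: (rl_chain laws).
- by rewrite /= !inE !negb_or il !(WV ht).
- by apply: Xc => //; rewrite mem_cat lW.
by apply: Xc; rewrite ?mem_cat ?V ?orbT // /= !inE !negb_or ij !(WV ht).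
Qed.

Lemma unmoved X t i j l : cell_like X -> i \in W -> j \in W ->
  l \in W -> uniq [:: i; j; l] -> s l (v t) (X i j) = X i j.
Proof.
move=> [Xc _] iW jW lW u; apply: (rl_id laws).
by apply: Xc => //; rewrite mem_cat lW.
Qed.

(** The base with its apex moved to the spare dimension [v t], which leaves [w3] free for another
    apex. *)
Let A t := s w3 (v t) (P t).

Let A_closed t u : (0 < t < 4)%N -> (0 < u < 4)%N -> v u != v t ->
  c (v u) (A t) = A t.
Proof.
move=> ht hu tu; apply: (rl_ck laws) => //; last by apply: P_closed; apply: V.
by rewrite eq_sym WV.
Qed.

Let A_w3 t : (0 < t < 4)%N -> c w3 (A t) = A t.
Proof. by move=> ht; apply: (rl_cs laws); apply: WV. Qed.

Let P_le t : (t < 4)%N -> P t <= base.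
Proof. by move=> /P_base <-; apply: (rl_ext laws). Qed.

Let A_le t : (0 < t < 4)%N -> A t <= base.
Proof.
move=> ht; have /andP[_ /P_le h] := ht.
by rewrite -[base](rl_id laws (v t) base_closed); apply: s_mono.
Qed.

(** Since [c w3 (P t)] is the base, every nonzero element below the base that is independent of [w3]
    meets [P t]. The variant for [A t] follows by renaming [v t] to [w3]. *)
Let kill_P y t : (t < 4)%N -> c w3 y = y -> y <= base -> y `&` P t = \bot -> y = \bot.
Proof.
move=> ht cy yb e; have : c w3 (P t `&` y) = \bot by rewrite meetC e (rl_c0 laws).
by rewrite (rl_cI laws) // P_base // => <-; apply/esym/meet_idPr.
Qed.

Let kill_A y t : (0 < t < 4)%N -> c w3 y = y -> c (v t) y = y -> y <= base ->
  y `&` A t = \bot -> y = \bot.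
Proof.
move=> ht cy cvy yb e; have /andP[_ t4] := ht; apply: (kill_P t4) => //.
have := endo_bot (rl_endo laws (v t) w3); rewrite -e sI (rl_id laws) //.
by rewrite (rl_back laws) // ?WV //; apply: P_closed; apply: V.
Qed.

(** [E] is a base with all four apexes at once. The pigeonhole principle makes it zero, and the
    apexes [0], [3], [2] are then removed one after another until [A 1], and with it [P 1],
    vanishes. *)
Lemma core_contradiction : P 1 = \bot.
Proof.
pose E := P 0 `&` (A 1 `&` (A 2 `&` A 3)).
suff E0 : E = \bot.
  have [v12 v13 v23] : [/\ v 1 != v 2, v 1 != v 3 & v 2 != v 3].
    by split; apply: VV.
  have A1 : A 1 = \bot.
    apply: (@kill_A _ 2); rewrite ?A_w3 ?A_closed ?A_le // 1?eq_sym //.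
    have h12 : c w3 (A 1 `&` A 2) = A 1 `&` A 2 by apply: closedI; apply: A_w3.
    have l12 : A 1 `&` A 2 <= base by rewrite leIxl ?A_le.
    apply: (@kill_A _ 3) => //.
      by apply: closedI; apply: A_closed => //; rewrite eq_sym.
    apply: (@kill_P _ 0) => //.
    - by apply: closedI => //; apply: A_w3.
    - by rewrite leIxl.
    by rewrite meetC -meetA.
  have := endo_bot (rl_endo laws (v 1) w3).
  by rewrite -{1}A1 (rl_back laws) // ?WV //; apply: P_closed; apply: V.
have u123 : uniq [:: w1; w2; w3] by rewrite /= !inE !negb_or w12 w13 w23.
have u132 : uniq [:: w1; w3; w2] by rewrite /= !inE !negb_or w12 w13 eq_sym w23.
have u213 : uniq [:: w2; w1; w3] by rewrite /= !inE !negb_or eq_sym w12 w13 w23.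
have u231 : uniq [:: w2; w3; w1] by rewrite /= !inE !negb_or w23 ![_ == w1]eq_sym w12 w13.
have u321 : uniq [:: w3; w2; w1].
  by rewrite /= !inE !negb_or ![w3 == _]eq_sym w23 w13 eq_sym w12.
(* [psi] relates the distinguished apex in [w3] to the one in [v t]; [phi] relates those in [v t]
   and [v u]. *)
pose psi (X : nat -> nat -> J -> J -> B) t := s w2 (v t) (X 0 t w3 w2).
pose phi (X : nat -> nat -> J -> J -> B) t u := s w3 (v u) (s w2 (v t) (X t u w2 w3)).
have EA t : (0 < t < 4)%N -> E <= A t.
  case: t => [|[|[|[|t]]]] // _; rewrite /E.
  - by rewrite leIxr // leIxl.
  - by rewrite leIxr // leIxr // leIxl.
  by rewrite leIxr // leIxr // leIxr.
have Eal0 : E <= al 0 w1 w3 by rewrite leIxl.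
have Ebe0 : E <= be 0 w2 w3 by rewrite leIxl.
have Eal t : (0 < t < 4)%N -> E <= s w3 (v t) (al t w1 w3).
  by move=> ht; apply: le_trans (EA t ht) _; apply: s_mono.
have Ebe t : (0 < t < 4)%N -> E <= s w3 (v t) (be t w2 w3).
  by move=> ht; apply: le_trans (EA t ht) _; apply: s_mono.
have Epsi t : (0 < t < 4)%N -> E <= psi red t.
  move=> ht; have /andP[t0 _] := ht.
  (* Each mark condition uses one base point, so the dimension of the other is free: apex [t] passes
     through [w2] for the marks at [w1], and through [w1] for those at [w2]. *)
  have h1 : E <= psi n1 t.
    have := s_mono w2 (v t) (al_n1 t0 W3 W2 u132).
    rewrite sI (unmoved _ (alC 0) W1 W3 W2 u132) (moved2 (alC t) ht W1 W3 W2 u132).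
    by apply: le_trans; rewrite lexI Eal0 Eal.
  have h2 : E <= psi n2 t.
    have := s_mono w1 (v t) (be_n2 t0 W3 W1 u231).
    rewrite sI (unmoved _ (beC 0) W2 W3 W1 u231) (moved2 (beC t) ht W2 W3 W1 u231).
    rewrite (moved2 (n2C 0 t) ht W3 W2 W1 u321).
    by apply: le_trans; rewrite lexI Ebe0 Ebe.
  have := s_mono w2 (v t) (@n1_n2 0 t _ _ W3 W2 _).
  rewrite sI eq_sym w23 => /(_ isT); apply: le_trans.
  by rewrite lexI h1 h2.
have Epsi2 t : (0 < t < 4)%N -> E <= psi (cl false) t `|` psi (cl true) t.
  move=> ht; apply: le_trans (Epsi t ht) _.
  rewrite /psi -(rl_endo laws w2 (v t)).1; apply: s_mono; apply: red_cl => //.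
  by rewrite eq_sym.
have Ephi t u : (0 < t < u)%N -> (u < 4)%N -> E <= phi red t u.
  move=> tu u4; have ht : (0 < t < 4)%N by case/andP: tu => -> h; exact: ltn_trans h u4.
  have hu : (0 < u < 4)%N by case/andP: tu => h1 h2; rewrite u4 (ltn_trans h1 h2).
  have tu' : (t < u)%N by case/andP: tu.
  have cw3 x : s w3 (v u) (s w3 (v t) x) = s w3 (v t) x.
    by apply: (rl_id laws); apply: (rl_cs laws); apply: WV.
  have h1 : E <= phi n1 t u.
    have := s_mono w3 (v u) (s_mono w2 (v t) (al_n1 tu' W2 W3 u123)).
    rewrite !sI (unmoved _ (alC u) W1 W3 W2 u132) (moved2 (alC t) ht W1 W3 W2 u132).
    by rewrite cw3; apply: le_trans; rewrite lexI !Eal.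
  have h2 : E <= phi n2 t u.
    have := s_mono w3 (v u) (s_mono w1 (v t) (be_n2 tu' W1 W3 u213)).
    rewrite !sI (unmoved _ (beC u) W2 W3 W1 u231) (moved2 (beC t) ht W2 W3 W1 u231).
    rewrite (moved1 (n2C t u) ht W2 W3 W1 u231).
    by rewrite cw3; apply: le_trans; rewrite lexI !Ebe.
  have := s_mono w3 (v u) (s_mono w2 (v t) (@n1_n2 t u _ _ W2 W3 w23)).
  by rewrite !sI; apply: le_trans; rewrite lexI h1 h2.
have Ecl e t u : (0 < t < u)%N -> (u < 4)%N ->
    E `&` (psi (cl e) t `&` psi (cl e) u) = \bot.
  move=> tu u4; have ht : (0 < t < 4)%N by case/andP: tu => -> h; exact: ltn_trans h u4.
  have hu : (0 < u < 4)%N by case/andP: tu => h1 h2; rewrite u4 (ltn_trans h1 h2).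
  have w3v : w3 != v t by apply: WV.
  have w1v : w1 != v t by apply: WV.
  have w2u : w2 != v u by apply: WV.
  have w3u : w3 != v u by apply: WV.
  (* The mate condition wants all three apexes inside [W], with [t] and [u] in place of the base
     points. Moving them out from there gives the same relation as [phi]. *)
  have redE : s w2 (v u) (s w1 (v t) (red t u w1 w2)) = phi red t u.
    rewrite /phi -(moved1 (redC t u) ht W2 W3 W1 u231).
    have [rc rs] := redC t u.
    have c2 : c w2 (red t u w1 w3) = red t u w1 w3.
      by apply: rc => //; rewrite mem_cat W2.
    have cv k : k \in [:: v 1; v 2; v 3] -> uniq [:: w1; w3; k] ->
      c k (red t u w1 w3) = red t u w1 w3.
      by move=> kV uk; apply: rc => //; rewrite mem_cat kV orbT.
    have cu : c (v u) (red t u w1 w3) = red t u w1 w3.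
      by apply: cv; rewrite ?V //= !inE !negb_or w13 !(WV hu).
    have ct : c (v t) (red t u w1 w3) = red t u w1 w3.
      by apply: cv; rewrite ?V //= !inE !negb_or w13 !(WV ht).
    have vtu := VV tu u4.
    rewrite -(rl_chain laws (i := w3) (j := w2) (l := v u)).
    - rewrite [s w3 w2 _](rl_comm laws) //.
        by case: (rs w1 w3 w2 W1 W3 W2 u132) => _ ->.
      rewrite /= !inE !negb_or (eq_sym w3 w2) w23 (eq_sym w3 w1) w13 w3v.
      by rewrite (eq_sym w2 w1) w12 (WV ht W2) w1v.
    - by rewrite /= !inE !negb_or eq_sym w23 w3u w2u.
    - by apply: (rl_ck laws) => //; [rewrite eq_sym|apply: WV].
    by apply: (rl_ck laws) => //; rewrite eq_sym // WV.
  apply/eqP; rewrite -lex0.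
  have := s_mono w2 (v u) (s_mono w1 (v t) (cl_red e tu)).
  rewrite !(endo_bot (rl_endo laws _ _)) !sI redE; apply: le_trans.
  rewrite leI2 ?Ephi // leI2 //.
    rewrite (moved2 (clC e 0 t) ht W3 W2 W1 u321).
    by rewrite (rl_id laws) //; apply: (rl_cs laws); apply: WV.
  by rewrite (unmoved _ (clC e 0 u) W3 W2 W1 u321).
(* If the red at apex [1] has class [e], those at [2] and [3] both have the other class, which [Ecl]
   excludes for this pair as well. *)
have pigeon e : E `&` psi (cl e) 1 = \bot.
  have h t : (1 < t < 4)%N -> E `&` psi (cl e) 1 <= psi (cl (~~ e)) t.
    move=> /andP[t1 t4].
    have ht : (0 < t < 4)%N by rewrite t4 (ltn_trans _ t1).
    have le : E `&` psi (cl e) 1 <= psi (cl e) t `|` psi (cl (~~ e)) t.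
      apply: le_trans (leIl _ _) (le_trans (Epsi2 t ht) _).
      by case: (e); rewrite //= joinC.
    rewrite -(meet_idPl le) meetUr -meetA Ecl ?t1 // join0x; exact: leIr.
  apply/eqP; rewrite -lex0 -(@Ecl (~~ e) 2 3) // lexI leIl lexI !h //.
by rewrite -(meet_idPl (Epsi2 1 isT)) meetUr !pigeon joinx0.
Qed.

End Core.

(** * Algebras of sets *)

Section FieldOfSets.
Variables (T : Type) (P : set T -> Prop).

Record field_of_sets : Prop := FieldOfSets {
  fos_setU : forall A B, P A -> P B -> P (A `|` B)%classic;
  fos_setC : forall A, P A -> P (~` A)%classic;
  fos_set0 : P set0 }.

(** The closure proof is a parameter of the type, so that the lattice instances can be attached to
    it. *)
Definition fos (hP : field_of_sets) : Type := {X : set T | P X}.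

Hypothesis hP : field_of_sets.
Local Notation F := (fos hP).

Lemma fos_setI A B : P A -> P B -> P (A `&` B)%classic.
Proof.
move=> hA hB; rewrite -[(A `&` B)%classic]setCK setCI.
by apply: (fos_setC hP); apply: (fos_setU hP); apply: (fos_setC hP).
Qed.

Lemma fos_setD A B : P A -> P B -> P (A `\` B)%classic.
Proof. by move=> hA hB; rewrite setDE; apply: fos_setI => //; apply: (fos_setC hP). Qed.

Lemma fos_setT : P setT.
Proof. by rewrite -setC0; apply: (fos_setC hP); apply: (fos_set0 hP). Qed.

Definition fos_le (A B : F) := `[< (sval A `<=` sval B)%classic >].
Definition fos_meet (A B : F) : F := exist _ _ (fos_setI (svalP A) (svalP B)).
Definition fos_join (A B : F) : F := exist _ _ (fos_setU hP (svalP A) (svalP B)).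
Definition fos_diff (A B : F) : F := exist _ _ (fos_setD (svalP A) (svalP B)).
Definition fos_bot : F := exist _ _ (fos_set0 hP).
Definition fos_top : F := exist _ _ fos_setT.
Definition fos_compl (A : F) : F := exist _ _ (fos_setC hP (svalP A)).

Lemma fos_inj (A B : F) : sval A = sval B -> A = B.
Proof.
by case: A B => [A hA] [B hB] /= e; subst B; congr exist; apply: Prop_irrelevance.
Qed.

End FieldOfSets.

HB.instance Definition _ T P (hP : @field_of_sets T P) := gen_eqMixin (fos hP).
HB.instance Definition _ T P (hP : @field_of_sets T P) := gen_choiceMixin (fos hP).

Section Instances.
Variables (T : Type) (P : set T -> Prop) (hP : field_of_sets P).
Local Notation F := (fos hP).
Implicit Types A B C : F.

Let le_def A B : fos_le A B = (fos_meet A B == A).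
Proof.
apply/asboolP/eqP => [h|/(congr1 sval) /= <-]; last exact: subIsetr.
by apply: fos_inj; apply/setIidPl.
Qed.

Definition fos_lt A B := (B != A) && fos_le A B.

Let lt_def A B : fos_lt A B = (B != A) && fos_le A B.
Proof. by []. Qed.

Let meetC A B : fos_meet A B = fos_meet B A.
Proof. exact/fos_inj/setIC. Qed.
Let joinC A B : fos_join A B = fos_join B A.
Proof. exact/fos_inj/setUC. Qed.
Let meetA A B C : fos_meet A (fos_meet B C) = fos_meet (fos_meet A B) C.
Proof. exact/fos_inj/setIA. Qed.
Let joinA A B C : fos_join A (fos_join B C) = fos_join (fos_join A B) C.
Proof. exact/fos_inj/setUA. Qed.
Let joinKI B A : fos_meet A (fos_join A B) = A.
Proof. by apply: fos_inj; rewrite /= setUC setKU. Qed.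
Let meetKU B A : fos_join A (fos_meet A B) = A.
Proof. by apply: fos_inj; rewrite /= setIC setKI. Qed.
Let meetUl A B C : fos_meet (fos_join A B) C = fos_join (fos_meet A C) (fos_meet B C).
Proof. exact/fos_inj/setIUl. Qed.
Let meetxx A : fos_meet A A = A.
Proof. exact/fos_inj/setIid. Qed.

HB.instance Definition _ := Order.isMeetJoinDistrLattice.Build set_display F
  le_def lt_def meetC joinC meetA joinA joinKI meetKU meetUl meetxx.

Let bot_le A : (fos_bot hP <= A)%O.
Proof. by apply/asboolP; exact: sub0set. Qed.
Let le_top A : (A <= fos_top hP)%O.
Proof. by apply/asboolP; exact: subsetT. Qed.

HB.instance Definition _ := Order.hasBottom.Build set_display F bot_le.
HB.instance Definition _ := Order.hasTop.Build set_display F le_top.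

Let diffKI A B : B `&` fos_diff A B = \bot.
Proof. by apply: fos_inj; rewrite /= setDE setICA setICr setI0. Qed.
Let joinIB A B : (A `&` B) `|` fos_diff A B = A.
Proof. by apply: fos_inj; rewrite /= setUC -setDDr setDv setD0. Qed.

HB.instance Definition _ := Order.BDistrLattice_hasSectionalComplement.Build
  set_display F diffKI joinIB.

Let complE A : fos_compl A = fos_diff (fos_top hP) A.
Proof. by apply: fos_inj; rewrite /= setTD. Qed.

HB.instance Definition _ := Order.CBDistrLattice_hasComplement.Build
  set_display F complE.

End Instances.

(** * The equations in full set algebras *)

Section SetAlgebraLaws.
Variables (I : eqType) (U : Type).
Local Notation S := (set (I -> U) : ctbDistrLatticeType _).
Implicit Types (X Y : set (I -> U)) (f g : I -> U) (i j k l : I).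

Definition cyl i (X : set (I -> U)) : set (I -> U) :=
  [set f | exists2 g, X g & forall j, j != i -> g j = f j].
Definition sub i j (X : set (I -> U)) : set (I -> U) :=
  [set f | X (fun k => f (repl i j k))].
Definition swap i j (X : set (I -> U)) : set (I -> U) :=
  [set f | X (fun k => f (transp i j k))].
Definition dia i j : set (I -> U) := [set f | f i = f j].

Lemma set_ext (T : Type) (X Y : set T) : (forall t, X t <-> Y t) -> X = Y.
Proof. by move=> h; apply/seteqP; split=> t /h. Qed.

Lemma sub_le X Y : (forall t, X t -> Y t) -> (X : S) <= Y.
Proof. by move=> h; apply/asboolP. Qed.

Lemma repl_id i k : repl i i k = k.
Proof. by rewrite /repl; case: eqP. Qed.

Lemma sub_id i X : sub i i X = X.
Proof.
apply: set_ext => f; rewrite /sub /=.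
by have -> : (fun k => f (repl i i k)) = f by apply: funext => k; rewrite repl_id.
Qed.

Lemma cyl_ext i X : (X : S) <= cyl i X.
Proof. by apply: sub_le => f Xf; exists f. Qed.

Lemma cyl_bot i : cyl i set0 = set0.
Proof. by apply: set_ext => f; split=> // -[]. Qed.

Lemma cyl_cylI i X Y : cyl i (X `&` cyl i Y)%classic = (cyl i X `&` cyl i Y)%classic.
Proof.
apply: set_ext => f; split.
  move=> [g [Xg [h Yh gh]] fg]; split; first by exists g.
  by exists h => // j ji; rewrite gh // fg.
move=> [[g Xg fg] [h Yh fh]]; exists g => //; split=> //.
by exists h => // j ji; rewrite fh // fg.
Qed.

Lemma cyl_comm i j X : cyl i (cyl j X) = cyl j (cyl i X).
Proof.
have h i' j' f : cyl i' (cyl j' X) f -> cyl j' (cyl i' X) f; last first.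
  by apply: set_ext => f; split; apply: h.
move=> [g [h Xh hg] gf].
have [e|ij] := eqVneq i' j'.
  by subst j'; exists g => //; exists h.
exists (fun l => if l == j' then h l else f l); last by move=> l /negbTE ->.
exists h => // l li; case: eqP => // /eqP lj.
by rewrite hg // gf.
Qed.

Lemma sub_endo i j : bool_endo (B := S) (sub i j).
Proof. by split=> [X Y|X]. Qed.

Lemma swap_endo i j : bool_endo (B := S) (swap i j).
Proof. by split=> [X Y|X]. Qed.

Lemma cyl_cong i X f g : (forall j, j != i -> f j = g j) -> cyl i X f -> cyl i X g.
Proof. by move=> fg [h Xh hf]; exists h => // j ji; rewrite hf ?fg. Qed.

Lemma repl_neq i j k : i != j -> repl i j k != i.
Proof. by rewrite /repl; case: (eqVneq k i) => // _; rewrite eq_sym. Qed.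

Lemma sub_cyl i j X : sub i j (cyl i X) = cyl i X.
Proof.
apply: set_ext => f; rewrite /sub /=.
by split; apply: cyl_cong => l li; rewrite /repl (negbTE li).
Qed.

Lemma cyl_sub i j X : i != j -> cyl i (sub i j X) = sub i j X.
Proof.
move=> ij; apply: set_ext => f; split; last by exists f.
move=> [g]; rewrite /sub /= => + gf.
by congr (X _); apply: funext => k; rewrite gf // repl_neq.
Qed.

Lemma sub_cyl_comm i j k X : k != i -> k != j ->
  sub i j (cyl k X) = cyl k (sub i j X).
Proof.
move=> ki kj; apply: set_ext => f; rewrite /sub /cyl /=; split.
  move=> [g Xg gf]; exists (fun l => if l == k then g k else f l); last first.
    by move=> l /negbTE ->.
  congr (X _): Xg; apply: funext => l.
  have [->|lk] := eqVneq l k; first by rewrite /repl (negbTE ki) eqxx.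
  rewrite gf // /repl; have [_|li] := eqVneq l i; last by rewrite (negbTE lk).
  by rewrite eq_sym (negbTE kj).
move=> [g Xg gf]; eexists; first exact: Xg.
by move=> l lk; apply: gf; rewrite /repl; case: (l == i) => //; rewrite eq_sym.
Qed.

Lemma cyl_sub_sym i j X : cyl i (sub j i X) = cyl j (sub i j X).
Proof.
have h i' j' f : cyl i' (sub j' i' X) f -> cyl j' (sub i' j' X) f; last first.
  by apply: set_ext => f; split; apply: h.
move=> [g]; rewrite /sub /= => Xg gf.
exists (fun l => if l == j' then g i' else f l); last by move=> l /negbTE ->.
congr (X _): Xg; apply: funext => l; rewrite /repl.
have [->|li] := eqVneq l i'; first by rewrite eqxx; case: eqP.
by have [_|lj] := eqVneq l j'; last by rewrite gf.
Qed.

Lemma sub_sub_comm i j k l X : uniq [:: i; j; k; l] ->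
  sub i j (sub k l X) = sub k l (sub i j X).
Proof.
rewrite /= !inE !negb_or !andbT => /and3P[/and3P[ij ik il] /andP[jk jl] kl].
apply: set_ext => f; rewrite /sub /=.
suff -> : (fun m => f (repl i j (repl k l m))) = (fun m => f (repl k l (repl i j m))).
  by [].
apply: funext => m; congr f; rewrite /repl.
have [->|mk] := eqVneq m k.
  by rewrite (eq_sym k) (negbTE ik) eqxx (eq_sym l) (negbTE il).
by have [_|mi] := eqVneq m i; rewrite ?(negbTE jk) ?(negbTE mk).
Qed.

Lemma sub_sub i j l X : sub i l (sub j i X) = sub i l (sub j l X).
Proof.
apply: set_ext => f; rewrite /sub /=.
suff -> : (fun m => f (repl i l (repl j i m))) = (fun m => f (repl i l (repl j l m))).
  by [].
apply: funext => m; congr f; rewrite /repl.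
have [_|//] := eqVneq m j; rewrite eqxx.
by case: (eqVneq l i) => // ->.
Qed.

Lemma set_Sc : Sc_eqs (B := S) cyl sub.
Proof.
split; first exact: cyl_bot.
split; first exact: cyl_ext.
split; first exact: cyl_cylI.
split; first exact: cyl_comm.
split; first exact: sub_id.
split; first exact: sub_endo.
split; first exact: sub_cyl.
split; first exact: cyl_sub.
split; first exact: sub_cyl_comm.
split; first exact: cyl_sub_sym.
split; first exact: sub_sub_comm.
exact: sub_sub.
Qed.

Lemma dia_refl i : dia i i = setT.
Proof. exact: set_ext. Qed.

Lemma dia_chain i j k : i != j -> i != k -> dia j k = cyl i (dia j i `&` dia i k)%classic.
Proof.
move=> ij ik; apply: set_ext => f; split.
  rewrite /dia /= => e; exists (fun l => if l == i then f j else f l).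
    by split; rewrite /= ?eqxx // eq_sym ?(negbTE ij) ?(negbTE ik).
  by move=> l /negbTE ->.
by move=> [g [/= ji ki] gf]; rewrite /dia /= -!gf 1?eq_sym // ji.
Qed.

Lemma cyl_dia i j X : i != j ->
  (cyl i (dia i j `&` X) `&` cyl i (dia i j `&` ~` X))%classic = set0.
Proof.
move=> ij; apply: set_ext => f; split=> // -[[g [/= gi Xg] gf] [h [/= hi nXh] hf]].
apply: nXh; congr (X _): Xg; apply: funext => l.
have [->|li] := eqVneq l i; last by rewrite gf ?hf.
by rewrite gi hi gf ?hf // eq_sym.
Qed.

Lemma set_CA : CA_eqs (B := S) cyl dia.
Proof.
split; first exact: cyl_bot.
split; first exact: cyl_ext.
split; first exact: cyl_cylI.
split; first exact: cyl_comm.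
split; first exact: dia_refl.
split; first exact: dia_chain.
exact: cyl_dia.
Qed.

Lemma transp_id i k : transp i i k = k.
Proof. by rewrite /transp; case: eqP. Qed.

Lemma transpC i j k : transp i j k = transp j i k.
Proof.
by rewrite /transp; have [->|ki] := eqVneq k i; have [e|kj] := eqVneq _ j.
Qed.

Lemma transpK i j k : transp i j (transp i j k) = k.
Proof.
rewrite /transp; have [->|ki] := eqVneq k i; first by rewrite eqxx; case: eqP.
have [->|kj] := eqVneq k j; first by rewrite eqxx.
by rewrite (negbTE ki) (negbTE kj).
Qed.

Lemma cylU_set i X Y : cyl i (X `|` Y)%classic = (cyl i X `|` cyl i Y)%classic.
Proof.
apply: set_ext => f; split.
  by move=> [g [Xg|Yg] gf]; [left|right]; exists g.
by move=> [[g Xg gf]|[g Yg gf]]; exists g => //; [left|right].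
Qed.

Lemma swap_swap i j k X : uniq [:: i; j; k] ->
  swap i j (swap i k X) = swap j k (swap i j X).
Proof.
rewrite /= !inE !negb_or !andbT => /andP[/andP[ij ik] jk].
apply: set_ext => f; rewrite /swap /=.
suff -> : (fun m => f (transp i j (transp i k m))) =
  (fun m => f (transp j k (transp i j m))) by [].
apply: funext => m; congr f; rewrite /transp.
have [ki kj] : (k == i) = false /\ (k == j) = false.
  by rewrite ![k == _]eq_sym (negbTE ik) (negbTE jk).
have [ei|mi] := eqVneq m i; first by rewrite ki kj !eqxx.
have [ek|mk] := eqVneq m k; first by rewrite ek kj kj !eqxx.
have [ej|mj] := eqVneq m j; first by rewrite (negbTE mi) (negbTE ij) (negbTE ik).
by rewrite (negbTE mi) (negbTE mj) (negbTE mk).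
Qed.

Lemma swap_sub i j X : swap i j (sub i j X) = sub j i X.
Proof.
apply: set_ext => f; rewrite /swap /sub /=.
suff -> : (fun m => f (transp i j (repl i j m))) = (fun m => f (repl j i m)) by [].
apply: funext => m; congr f; rewrite /transp /repl.
have [ei|mi] := eqVneq m i; last by rewrite (negbTE mi).
by rewrite eqxx ei; case: (eqVneq j i) => [->|_]; rewrite ?if_same.
Qed.

Lemma set_QA : QA_eqs (B := S) cyl sub swap.
Proof.
split; first exact: sub_id.
split.
  move=> i X; apply: set_ext => f; rewrite /swap /=.
  by have -> : (fun k => f (transp i i k)) = f by apply: funext => k; rewrite transp_id.
split.
  move=> i j X; apply: set_ext => f; rewrite /swap /=.
  suff -> : (fun k => f (transp i j k)) = (fun k => f (transp j i k)) by [].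
  by apply: funext => k; rewrite transpC.
split; first exact: cyl_ext.
split; first exact: cylU_set.
split; first exact: sub_cyl.
split; first exact: cyl_sub.
split; first exact: sub_cyl_comm.
split; first exact: sub_endo.
split; first exact: swap_endo.
split.
  move=> i j X; apply: set_ext => f; rewrite /swap /=.
  suff -> : (fun k => f (transp i j (transp i j k))) = f by [].
  by apply: funext => k; rewrite transpK.
split; first exact: swap_swap.
exact: swap_sub.
Qed.

Lemma set_QEA : QEA_eqs (B := S) cyl sub swap dia.
Proof.
split; first exact: set_QA.
split.
  move=> i j; apply: set_ext => f; split=> // _.
  by rewrite /sub /dia /= /repl eqxx; case: eqP.
move=> i j X; apply: sub_le => f [Xf fij]; rewrite /sub /=.
congr (X _): Xf; apply: funext => k; rewrite /repl.
by case: eqP => // ->.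
Qed.

End SetAlgebraLaws.

Lemma variety_full K (I : eqType) (U : Type) : variety (full_set_alg K I U).
Proof.
case: K; [exact: set_Sc|exact: set_CA|exact: set_QA|exact: set_QEA].
Qed.

Lemma variety_inj K (I : eqType) (A B : alg K I) (f : A -> B) :
  hom f -> injective f -> variety B -> variety A.
Proof.
move=> [f0 [f1 [fU [fI [fC [fo fc]]]]]] fi.
have fle x y : (x <= y) = (f x <= f y) by rewrite !leEmeet -fI (inj_eq fi).
have fendo o : bool_endo (@unop _ _ B o) -> bool_endo (@unop _ _ A o).
  move=> [hU hC]; split=> [x y|x]; apply: fi; rewrite !(fo, fU, fC) ?hU ?hC //.
have QA_pull (h h' : has_subst K) (t t' : has_transp K) :
  QA_eqs (fun i => @unop _ _ B (Cyl i)) (fun i j => @unop _ _ B (Defs.Sub h i j))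
    (fun i j => @unop _ _ B (Swap t i j)) ->
  QA_eqs (fun i => @unop _ _ A (Cyl i)) (fun i j => @unop _ _ A (Defs.Sub h i j))
    (fun i j => @unop _ _ A (Swap t i j)).
  move=> [h1 [h2 [h3 [h4 [h5 [h6 [h7 [h8 [h9 [h10 [h11 [h12 h13]]]]]]]]]]]].
  split; first by move=> i x; apply: fi; rewrite fo h1.
  split; first by move=> i x; apply: fi; rewrite fo h2.
  split; first by move=> i j x; apply: fi; rewrite !fo h3.
  split; first by move=> i x; rewrite fle fo h4.
  split; first by move=> i x y; apply: fi; rewrite !(fo, fU) h5.
  split; first by move=> i j x; apply: fi; rewrite !fo h6.
  split; first by move=> i j x ij; apply: fi; rewrite !fo h7.
  split; first by move=> i j k x ki kj; apply: fi; rewrite !fo h8.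
  split; first by move=> i j; apply: fendo.
  split; first by move=> i j; apply: fendo.
  split; first by move=> i j x; apply: fi; rewrite !fo h11.
  split; first by move=> i j k x u; apply: fi; rewrite !fo h12.
  by move=> i j x; apply: fi; rewrite !fo h13.
case: K A B f f0 f1 fU fI fC fo fc fi fle fendo QA_pull
  => A B f f0 f1 fU fI fC fo fc fi fle fendo QA_pull.
- move=> [h1 [h2 [h3 [h4 [h5 [h6 [h7 [h8 [h9 [h10 [h11 h12]]]]]]]]]]].
  split; first by move=> i; apply: fi; rewrite fo f0 h1.
  split; first by move=> i x; rewrite fle fo h2.
  split; first by move=> i x y; apply: fi; rewrite !(fo, fI) h3.
  split; first by move=> i j x; apply: fi; rewrite !fo h4.
  split; first by move=> i x; apply: fi; rewrite !fo h5.
  split; first by move=> i j; apply: fendo.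
  split; first by move=> i j x; apply: fi; rewrite !fo h7.
  split; first by move=> i j x ij; apply: fi; rewrite !fo h8.
  split; first by move=> i j k x ki kj; apply: fi; rewrite !fo h9.
  split; first by move=> i j x; apply: fi; rewrite !fo h10.
  split; first by move=> i j k l x u; apply: fi; rewrite !fo h11.
  by move=> i j l x; apply: fi; rewrite !fo h12.
- move=> [h1 [h2 [h3 [h4 [h5 [h6 h7]]]]]].
  split; first by move=> i; apply: fi; rewrite fo f0 h1.
  split; first by move=> i x; rewrite fle fo h2.
  split; first by move=> i x y; apply: fi; rewrite !(fo, fI) h3.
  split; first by move=> i j x; apply: fi; rewrite !fo h4.
  split; first by move=> i; apply: fi; rewrite fc f1 h5.
  split; first by move=> i j k ij ik; apply: fi; rewrite fo fI !fc; apply: h6.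
  by move=> i j x ij; apply: fi; rewrite f0 !(fI, fo) fC fc h7.
- exact: QA_pull.
move=> [h1 [h2 h3]]; split; first exact: QA_pull h1.
split; first by move=> i j; apply: fi; rewrite fo fc f1 h2.
by move=> i j x; rewrite fle fI fo fc h3.
Qed.

Section SubAlgebra.
Variables (K : kind) (I : eqType) (U : Type) (P : set (I -> U) -> Prop).
Hypothesis hP : field_of_sets P.
Local Notation full := (full_set_alg K I U).
Hypothesis hop : forall o X, P X -> P (@unop _ _ full o X).
Hypothesis hcst : forall c, P (const full c).

Definition set_subalg : alg K I :=
  @Alg K I _ (fos hP : ctbDistrLatticeType _)
    (fun o (X : fos hP) => exist _ _ (hop o (svalP X)))
    (fun c => exist _ _ (hcst c)).

Lemma sval_hom : hom (sval : set_subalg -> full).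
Proof. by []. Qed.

Lemma set_subalg_RK :
  variety set_subalg /\ subdirect_product (@set_algebra K I) set_subalg.
Proof.
split; first exact: variety_inj sval_hom (@fos_inj _ _ hP) (variety_full K I U).
exists unit, (fun _ => set_subalg), (fun _ => id); split.
  move=> _; exists full; split; first by exists U.
  by exists sval; split; [exact: sval_hom|exact: fos_inj].
by split=> //; split=> [_ y|x y /(_ tt)]; first by exists y.
Qed.

End SubAlgebra.

(** A map with an upper adjoint preserves existing suprema. Thus complete additivity requires no
    description of suprema of definable relations. *)
Lemma residual_supremum d (L : porderType d) (f r : L -> L) (X : set L) s :
  (forall x y, (f x <= y) = (x <= r y)) ->
  supremums X s -> supremums (f @` X)%classic (f s).
Proof.
move=> fr [us ls]; split=> [_ [x Xx <-]|y uy].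
  by rewrite fr (le_trans (us x Xx)) // -fr.
by rewrite fr; apply: ls => x Xx; rewrite -fr; apply: uy; exists x.
Qed.

(** * The algebra and its atoms *)

Section Algebra.
Variables (k : nat) (K : kind).
Local Notation n := k.+3.
Local Notation srt := point_sort.
Local Notation col := (edge_colour k).
Implicit Types (f g h : 'I_n -> nat) (X Y : set ('I_n -> nat)).

Lemma blurred_sym N f g : blurred N f g -> blurred N g f.
Proof.
move=> h; split=> [i _|i j _ _|w a b sw _ _ _].
- by rewrite (agree_srt h).
- by rewrite (agree_eq h).
by apply: blur_sym; apply: (agree_col h); rewrite ?all_predT.
Qed.

Lemma blurred_trans N g f h : blurred N f g -> blurred N g h -> blurred N f h.
Proof.
move=> fg gh; split=> [i _|i j _ _|w a b sw _ _ _].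
- by rewrite (agree_srt fg) // (agree_srt gh).
- by rewrite (agree_eq fg) // (agree_eq gh).
by apply: blur_trans (agree_col fg _ _ _ _) (agree_col gh _ _ _ _);
  rewrite ?all_predT.
Qed.

Lemma blurred_mono N N' f g : (N <= N')%N -> blurred N' f g -> blurred N f g.
Proof.
move=> le h; split=> [i _|i j _ _|w a b sw _ _ _].
- by rewrite (agree_srt h).
- by rewrite (agree_eq h).
by apply: blur_mono le _; apply: (agree_col h); rewrite ?all_predT.
Qed.

Lemma same_type_blurred N f g : same_type f g -> blurred N f g.
Proof.
move=> h; split=> [i _|i j _ _|w a b sw _ _ _].
- by rewrite (agree_srt h).
- by rewrite (agree_eq h).
by left; apply: (agree_col h); rewrite ?all_predT.
Qed.

Lemma same_type_refl f : same_type f f.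
Proof. by split. Qed.

Lemma same_type_sym f g : same_type f g -> same_type g f.
Proof.
move=> h; split=> [i _|i j _ _|w a b sw _ _ _].
- by rewrite (agree_srt h).
- by rewrite (agree_eq h).
by rewrite (agree_col h) ?all_predT.
Qed.

Lemma same_type_rhofree f g : same_type f g -> rhofree f -> rhofree g.
Proof. by move=> h hf w a b sw; rewrite -(agree_col h) ?all_predT //; apply: hf. Qed.

Lemma rhofree_comp f (t : 'I_n -> 'I_n) : rhofree f -> rhofree (f \o t).
Proof. by move=> hf w a b sw; rewrite map_comp; apply: hf; rewrite size_map. Qed.

Lemma upd_eq f g (i : 'I_n) : (forall j, j != i -> g j = f j) -> g = upd f i (g i).
Proof. by move=> h; apply: funext => j; rewrite /upd; case: eqP => [->|/eqP/h]. Qed.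

Lemma upd_id f (i : 'I_n) : upd f i (f i) = f.
Proof. by apply: funext => j; rewrite /upd; case: eqP => // ->. Qed.

Definition definable X := exists N, forall f g, blurred N f g -> X f -> X g.

Lemma definable_fos : field_of_sets definable.
Proof.
split.
- move=> X Y [N hX] [N' hY]; exists (maxn N N') => f g fg [Xf|Yf].
    by left; apply: hX Xf; apply: blurred_mono fg; apply: leq_maxl.
  by right; apply: hY Yf; apply: blurred_mono fg; apply: leq_maxr.
- move=> X [N hX]; exists N => f g fg nXf Xg; apply: nXf.
  by apply: hX Xg; apply: blurred_sym.
by exists 0%N.
Qed.

Lemma definable_cyl i X : definable X -> definable (cyl i X).
Proof.
move=> [N hX]; exists N => f g fg [h Xh hf].
have [v hv] := blurred_forth i (h i) fg.
exists (upd g i v); last by move=> j ji; rewrite upd_other.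
by apply: hX hv _; rewrite -(upd_eq hf).
Qed.

Lemma definable_comp (t : 'I_n -> 'I_n) X :
  definable X -> definable [set f : 'I_n -> nat | X (f \o t)]%classic.
Proof. by move=> [N hX]; exists N => f g fg; apply: hX; apply: agree_comp fg. Qed.

Lemma definable_op o X :
  definable X -> definable (@unop _ _ (full_set_alg K 'I_n nat) o X).
Proof.
case: o => [i|h i j|h i j].
- exact: definable_cyl.
- exact: definable_comp.
exact: definable_comp.
Qed.

Lemma definable_dia (i j : 'I_n) : definable (@dia _ nat i j).
Proof.
exists 0%N => f g fg; rewrite /dia /= => /eqP; rewrite (agree_eq fg) //.
by move=> /eqP.
Qed.

Lemma definable_cst c : definable (const (full_set_alg K 'I_n nat) c).
Proof. by case: c => h i j; apply: definable_dia. Qed.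

Definition definable_alg : alg K 'I_n :=
  set_subalg definable_fos definable_op definable_cst.

Local Notation D := definable_alg.

Lemma definable_RK : RK D.
Proof. exact: set_subalg_RK. Qed.

Lemma definable_le (x y : D) : (x <= y) = `[< (sval x `<=` sval y)%classic >].
Proof. by []. Qed.

Lemma definable_same_type (x : D) f g : same_type f g -> sval x f -> sval x g.
Proof. by case: x => X [N hX] /= fg; apply: hX; apply: same_type_blurred. Qed.

Lemma definable_neq_bot (x : D) : x <> \bot -> exists f, sval x f.
Proof.
move=> xb; apply/not_existsP => h; apply: xb; apply: fos_inj.
by apply: set_ext => f; split=> // /h.
Qed.

Lemma definable_type f : rhofree f -> definable (same_type f).
Proof.
move=> hf; have [N hN] := rhofree_bound hf; exists N => g h gh fg.
by apply: hN; apply: blurred_trans gh; apply: same_type_blurred.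
Qed.

Definition type_of f (hf : rhofree f) : D := exist _ _ (definable_type hf).

Lemma type_of_le f (hf : rhofree f) (x : D) : sval x f -> type_of hf <= x.
Proof.
move=> xf; rewrite definable_le; apply/asboolP => g fg.
exact: definable_same_type xf.
Qed.

Lemma type_of_atom f (hf : rhofree f) : is_atom (type_of hf).
Proof.
split.
  move=> /(congr1 sval) /= e; have : set0 f by rewrite -e; apply: same_type_refl.
  by [].
move=> x; have [->|/definable_neq_bot [g xg]] := pselect (x = \bot); first by left.
move=> le; right; apply/eqP; rewrite eq_le le /=; apply: type_of_le.
move: le; rewrite definable_le => /asboolP /(_ g xg) fg.
by apply: definable_same_type xg; apply: same_type_sym.
Qed.

Lemma definable_atomic : atomic D.
Proof.
move=> x /definable_neq_bot [f xf]; case: x xf => X [N hX] /= Xf.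
have [g [fg hg]] := rhofree_dense N f.
exists (type_of hg); first exact: type_of_atom.
by apply: type_of_le; apply: hX fg Xf.
Qed.

(** By density an atom contains a tuple without [rho]; the type of that tuple is definable, so it is
    the whole atom. *)
Lemma atom_rhofree (a : D) f : is_atom a -> sval a f -> rhofree f.
Proof.
move=> [/definable_neq_bot [g ag] amin] af.
case: a ag af amin => X [N hX] /= Xg Xf amin.
have [h [gh hh]] := rhofree_dense N g.
have xh : X h by apply: hX gh Xg.
have := amin _ (type_of_le hh (x := exist _ X (ex_intro _ N hX)) xh).
case=> [e|/(congr1 sval) /= e].
  by have [] := type_of_atom hh.
by apply: same_type_rhofree hh; rewrite e.
Qed.

Lemma atom_point (a : D) : is_atom a -> exists f, sval a f.
Proof. by move=> [/definable_neq_bot]. Qed.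

Lemma atom_le (a x : D) f : is_atom a -> sval a f -> sval x f -> a <= x.
Proof.
move=> ha af xf; have hf := atom_rhofree ha af.
have [e|<-] := ha.2 _ (type_of_le hf af); last exact: type_of_le.
by have [] := type_of_atom hf.
Qed.

Lemma definable_additive : completely_additive D.
Proof.
move=> o X s.
suff [r hr] : exists r : D -> D, forall x y, (unop o x <= y) = (x <= r y).
  exact: residual_supremum hr.
have cylC i x y : (forall f, cyl i x f -> y f) <->
    (forall f, x f -> ~ cyl i (~` y)%classic f).
  split=> [h f xf [g nyg gf]|h f [g xg gf]].
    by apply: nyg; apply: h; exists f => // j ji; rewrite gf.
  by apply: contrapT => nyf; apply: (h g xg); exists f => // j ji; rewrite gf.
have dC := fos_setC definable_fos; have dU := fos_setU definable_fos.
case: o => [i|h i j|h i j].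
- exists (fun y => exist _ (~` cyl i (~` sval y))%classic
    (dC _ (definable_cyl i (dC _ (svalP y))))) => x y.
  by rewrite !definable_le; apply: asbool_equiv_eq; apply: cylC.
- have [e|ij] := eqVneq i j.
    subst j; exists id => x y; rewrite !definable_le; apply: asbool_equiv_eq.
    by rewrite -[X in (_ `<=` _)%classic <-> (X `<=` _)%classic](@sub_id _ _ i (sval x)).
  (* [s i j x <= y] says that each tuple of [x] with equal entries at [i] and [j] has all its
     [i]-variants in [y]. *)
  exists (fun y => exist _ (~` @dia _ nat i j `|` ~` cyl i (~` sval y))%classic
    (dU _ _ (dC _ (definable_dia i j)) (dC _ (definable_cyl i (dC _ (svalP y)))))) => x y.
  rewrite !definable_le; apply: asbool_equiv_eq => /=; split=> hxy.
    move=> f xf; have [fij|] := pselect (f i = f j); last by left.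
    right=> -[g nyg gf]; apply: nyg; apply: hxy => /=.
    suff -> : (fun l => g (repl i j l)) = f by [].
    apply: funext => l; rewrite /repl; case: eqP => [->|/eqP li]; last exact: gf.
    by rewrite fij gf // eq_sym.
  move=> f /= xf; apply: contrapT => nyf.
  have [|] := hxy _ xf; apply.
    by rewrite /dia /= /repl eqxx eq_sym (negbTE ij).
  by exists f => // l li; rewrite /repl (negbTE li).
exists (fun y => exist _ _ (definable_op (Swap h i j) (svalP y))) => x y.
rewrite !definable_le; apply: asbool_equiv_eq => /=.
have tK f : (fun l => f (transp i j (transp i j l))) = f.
  by apply: funext => l; rewrite transpK.
split=> hxy f /= xf; last by have := hxy _ xf; rewrite /= tK.
by apply: hxy; rewrite /= tK.
Qed.

End Algebra.

Section ComplexAlgebra.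
Variables (k : nat) (K : kind).
Local Notation n := k.+3.
Local Notation srt := point_sort.
Local Notation col := (edge_colour k).
Local Notation D := (definable_alg k K).
Local Notation C := (Cm (At D)).
Local Notation pt := (points (At D)).
Implicit Types (f g h : 'I_n -> nat) (Q R : ('I_n -> nat) -> Prop) (a b : pt).

Definition type_invariant Q := forall f g, same_type f g -> Q f -> Q g.

(** [Q] has to respect types but need not be definable; this is how unions of infinitely many red
    copies become elements. *)
Definition atoms_in Q : C := [set a : pt | exists2 f, sval (sval a) f & Q f]%classic.

Lemma point_rep (a : pt) : exists f, sval (sval a) f.
Proof. by apply: atom_point; apply: (svalP a). Qed.

Lemma point_rhofree (a : pt) f : sval (sval a) f -> rhofree f.
Proof. exact: atom_rhofree (svalP a). Qed.

Lemma point_same (a : pt) f g : sval (sval a) f -> sval (sval a) g -> same_type f g.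
Proof.
move=> af ag; have hf := point_rhofree af.
by have := atom_le (svalP a) af (same_type_refl f : sval (type_of K hf) f);
  rewrite (@definable_le k K) => /asboolP /(_ g ag).
Qed.

Definition point_of f (hf : rhofree f) : pt := exist _ _ (type_of_atom K hf).

Lemma atoms_inE Q a f : type_invariant Q -> sval (sval a) f -> atoms_in Q a <-> Q f.
Proof.
move=> iQ af; split=> [[g ag Qg]|Qf]; last by exists f.
exact: iQ (point_same ag af) Qg.
Qed.

Lemma Cm_le (x y : C) : (forall a, x a -> y a) -> x <= y.
Proof. by move=> h; apply/asboolP. Qed.

Lemma Cm_ext (x y : C) : (forall a, x a <-> y a) -> x = y.
Proof. exact: set_ext. Qed.

Lemma atoms_in_le Q R : (forall f, rhofree f -> Q f -> R f) -> atoms_in Q <= atoms_in R.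
Proof.
move=> h; apply: Cm_le => a [f af Qf]; exists f => //; apply: h Qf.
exact: point_rhofree af.
Qed.

(** The witness has to be free of [rho] because only such types are points of the atom structure. *)
Lemma cyl_atoms_in Q i a f : type_invariant Q -> sval (sval a) f ->
  @unop _ _ C (Cyl i) (atoms_in Q) a <-> exists2 u, rhofree (upd f i u) & Q (upd f i u).
Proof.
move=> iQ af; split.
  move=> [b [g0 bg0 Qg0] /=].
  rewrite (@definable_le k K) => /asboolP /(_ f af) /= [g bg gf].
  have e := upd_eq gf; exists (g i); rewrite -e; first exact: point_rhofree bg.
  exact: iQ (point_same bg0 bg) Qg0.
move=> [u hu Qu]; exists (point_of hu).
  by exists (upd f i u) => //; apply: same_type_refl.
apply: (atom_le (svalP a) af); exists (upd f i u); first exact: same_type_refl.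
by move=> j ji; rewrite upd_other.
Qed.

Lemma sub_atoms_in Q hK i l a f : type_invariant Q -> sval (sval a) f ->
  @unop _ _ C (Defs.Sub hK i l) (atoms_in Q) a <-> Q (f \o repl i l).
Proof.
move=> iQ af; split.
  move=> [b [g0 bg0 Qg0] /=]; rewrite (@definable_le k K) => /asboolP /(_ f af) /= bg.
  exact: iQ (point_same bg0 bg) Qg0.
have hf := rhofree_comp (repl i l) (point_rhofree af).
move=> Qf; exists (point_of hf).
  by exists (f \o repl i l) => //; apply: same_type_refl.
by apply: (atom_le (svalP a) af); apply: same_type_refl.
Qed.

Lemma diag_atoms_in hK i l a f : sval (sval a) f ->
  const C (Diag hK i l) a <-> f i = f l.
Proof.
move=> af; split=> [|fil]; last exact: (atom_le (svalP a) af).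
by rewrite /= (@definable_le k K) => /asboolP /(_ f af).
Qed.

End ComplexAlgebra.

Lemma replacement_atoms_in k K (Q : ('I_k.+3 -> nat) -> Prop) i l
    (a : points (At (definable_alg k K))) f : type_invariant Q -> sval (sval a) f ->
  @replacement K _ (Cm (At (definable_alg k K))) i l (atoms_in Q) a <-> Q (f \o repl i l).
Proof.
case: K a => a iQ af; try exact: sub_atoms_in.
rewrite /=; have [e|il] := eqVneq i l.
  have -> : f \o repl i l = f by subst l; apply: funext => j /=; rewrite repl_id.
  exact: atoms_inE.
pose Q' g := g i = g l /\ Q g.
have iQ' : type_invariant Q'.
  move=> g h gh [/eqP gil Qg]; split; last exact: iQ Qg.
  by apply/eqP; rewrite -(agree_eq gh).
have -> : const (Cm (At (definable_alg k CA))) (Diag (K:=CA) isT i l) `&` atoms_in Q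
    = atoms_in Q' :> Cm (At (definable_alg k CA)).
  apply: Cm_ext => b; have [g bg] := point_rep b; split.
    by move=> [/(@diag_atoms_in k CA isT i l b g bg) gil /(atoms_inE iQ bg) Qg]; exists g.
  move/(atoms_inE iQ' bg) => [gil Qg]; split; last by exists g.
  exact/(@diag_atoms_in k CA isT i l b g bg).
apply: (iff_trans (cyl_atoms_in i iQ' af)); split.
  move=> [u _ [+ Qu]]; rewrite upd_same upd_other ?(eq_sym l) // => e.
  congr (Q _): Qu; apply: funext => j; rewrite /upd /repl /=.
  by case: (j == i).
move=> Qf; have E : upd f i (f l) = f \o repl i l.
  by apply: funext => j; rewrite /upd /repl /=; case: eqP.
exists (f l); first by rewrite E; apply: rhofree_comp; apply: point_rhofree af.
by split; [rewrite upd_same upd_other // eq_sym|rewrite E].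
Qed.

(** * The complex algebra *)

Section Cells.
Variables (k : nat) (K : kind).
Local Notation n := k.+3.
Local Notation srt := point_sort.
Local Notation col := (edge_colour k).
Local Notation C := (Cm (At (definable_alg k K))).
Implicit Types (f g h : 'I_n -> nat).

Definition psorted f := params k srt (map f (ppos k)).

Definition cellP (R : nat -> nat -> colour -> Prop) (i j : 'I_n) f :=
  psorted f /\ R (srt (f i)) (srt (f j)) (col (map f (ppos k)) (f i) (f j)).

Lemma psorted_invariant : type_invariant psorted.
Proof.
move=> f g fg; rewrite /psorted /params => <-; rewrite -!map_comp.
by apply: eq_map => i /=; rewrite (agree_srt fg).
Qed.

Lemma cellP_invariant R i j : type_invariant (cellP R i j).
Proof.
move=> f g fg [pf Rf]; split; first exact: psorted_invariant pf.
rewrite -!(agree_srt fg) // -(agree_col fg) ?all_predT //; exact: size_ppos.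
Qed.

Definition cell R i j : C := atoms_in (cellP R i j).

Let W : seq 'I_n := [:: xpos k; ypos k; zpos k].

Lemma W_ppos i : i \in W -> i \notin ppos k.
Proof.
rewrite pposE !inE => /or3P[] /eqP->; rewrite -leqNgt /= ?inordK //; lia.
Qed.

Lemma W_uniq : uniq W.
Proof.
rewrite -(map_inj_uniq val_inj) /= !inordK //; last lia.
rewrite !inE !negb_or; lia.
Qed.

Lemma cyl_cell R i j l : l \in W -> l != i -> l != j ->
  @unop _ _ C (Cyl l) (cell R i j) = cell R i j.
Proof.
move=> lW li lj; apply: Cm_ext => a; have [f af] := point_rep a.
have pE u : map (upd f l u) (ppos k) = map f (ppos k).
  apply/eq_in_map => m mp; rewrite upd_other //.
  by apply: contraTneq mp => ->; apply: W_ppos.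
apply: (iff_trans (cyl_atoms_in l (@cellP_invariant R i j) af)).
apply: iff_trans (iff_sym (atoms_inE (@cellP_invariant R i j) af)).
rewrite /cellP /psorted; split=> [[u _]|h].
  by rewrite pE !upd_other // eq_sym.
exists (f l); rewrite upd_id //; exact: point_rhofree af.
Qed.

Lemma replacement_cell R i j l : i \in W -> l \in W -> j != i ->
  @replacement K _ C i l (cell R i j) = cell R l j /\
  @replacement K _ C i l (cell R j i) = cell R j l.
Proof.
move=> iW lW ji.
have pE f : map (f \o repl i l) (ppos k) = map f (ppos k).
  apply/eq_in_map => m mp /=; rewrite /repl ifN //.
  by apply: contraTneq mp => ->; apply: W_ppos.
split; apply: Cm_ext => a; have [f af] := point_rep a;
  apply: (iff_trans (replacement_atoms_in i l (@cellP_invariant R _ _) af));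
  apply: iff_trans (iff_sym (atoms_inE (@cellP_invariant R _ _) af));
  by rewrite /cellP /psorted pE /= /repl eqxx (negbTE ji).
Qed.

(** Sorts of apexes are counted from [k.+2], so that [t = 0] is the distinguished sort. *)
Definition left_apex t a b (c : colour) := [/\ a = k, b = (k.+2 + t)%N & c = mark].
Definition right_apex t a b (c : colour) := [/\ a = k.+1, b = (k.+2 + t)%N & c = mark].
Definition apex_pair (Q : pred colour) t u a b c :=
  [/\ a = (k.+2 + t)%N, b = (k.+2 + u)%N & Q c].
Definition red_or_mark (c : colour) := isred c || (c == mark).
Definition not_mark (c : colour) := c != mark.
Definition red_class e (c : colour) := if c is inr (Some (e', _)) then e == e' else false.

Definition baseP := cellP (fun a b c => [/\ a = k, b = k.+1 & c = base_colour k])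
  (xpos k) (ypos k).
Definition apexP t f := [/\ baseP f, cellP (left_apex t) (xpos k) (zpos k) f &
  cellP (right_apex t) (ypos k) (zpos k) f].

Lemma apexP_invariant t : type_invariant (apexP t).
Proof. by move=> f g fg [h1 h2 h3]; split; apply: cellP_invariant fg _. Qed.

Lemma baseP_srt f : baseP f -> forall i : 'I_n, i != zpos k -> srt (f i) = i.
Proof.
move=> [pf [sx sy _]] i iz.
have [ik|] := ltnP i k.
  have := congr1 (nth 0%N ^~ i) pf; rewrite -!map_comp (nth_map 0%N) ?size_iota //=.
  by rewrite nth_iota // add0n inord_val.
rewrite leq_eqVlt => /orP[/eqP e|ki].
  have -> : i = xpos k by apply: val_inj; rewrite /= inordK //; lia.
  by rewrite sx /= inordK //; lia.
have iz2 : (nat_of_ord i) <> k.+2 by move=> e; case/eqP: iz; apply: val_inj.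
have -> : i = ypos k.
  apply: val_inj; rewrite /= inordK; last lia.
  by have := ltn_ord i; move: ki iz2; lia.
by rewrite sy /= inordK //; lia.
Qed.

(** [base_colour] admits exactly the sorts [k.+2 + t] with [t < 4], and [apex_exists] supplies the
    apex. *)
Lemma cyl_apex t : (t < 4)%N ->
  @unop _ _ C (Cyl (zpos k)) (atoms_in (apexP t)) = atoms_in baseP.
Proof.
move=> t4; have iB : type_invariant baseP by apply: cellP_invariant.
apply: Cm_ext => a; have [f af] := point_rep a.
apply: (iff_trans (cyl_atoms_in (zpos k) (@apexP_invariant t) af)).
apply: iff_trans (iff_sym (atoms_inE iB af)).
have pE u : map (upd f (zpos k) u) (ppos k) = map f (ppos k).
  apply/eq_in_map => m mp; rewrite upd_other //.
  by apply: contraTneq mp => ->; apply: W_ppos; rewrite !inE eqxx !orbT.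
have := W_uniq; rewrite /= !inE negb_or andbT => /andP[/andP[_ xz] yz].
have BE u : baseP (upd f (zpos k) u) <-> baseP f.
  by rewrite /baseP /cellP /psorted pE !upd_other.
split=> [[u _ [/BE //]]|Bf].
have [|u [su xu yu hu]] :=
  apex_exists (baseP_srt Bf) (leq_addr t k.+2) _ (point_rhofree af).
  have [_ [_ _ ->]] := Bf; rewrite /= !inE; lia.
exists u => //; have [pf _] := Bf; split; first exact/BE.
  rewrite /cellP /psorted pE upd_same upd_other //; split=> //; split=> //.
  by have [_ []] := Bf.
rewrite /cellP /psorted pE upd_same upd_other //; split=> //; split=> //.
by have [_ []] := Bf.
Qed.

Lemma apex_nonempty : atoms_in (apexP 1) <> \bot :> C.
Proof.
have [f [hs hz hc hf]] := base_exists k.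
have pf : psorted f.
  rewrite /psorted /params -!map_comp -[RHS]map_id; apply/eq_in_map => m.
  rewrite mem_iota add0n /= => mk; rewrite hs ?inordK //; first lia.
  by rewrite -val_eqE /= inordK //; lia.
have := W_uniq; rewrite /= !inE negb_or andbT => /andP[/andP[_ xz] yz].
have Bf : baseP f.
  by split=> //; split; rewrite // hs // inordK //; lia.
have Ba : atoms_in baseP (point_of K hf).
  by exists f => //; apply: same_type_refl.
rewrite -(@cyl_apex 1 isT) in Ba.
case: Ba => b [g bg Qg] _ e.
have : atoms_in (apexP 1) b by exists g.
by rewrite e.
Qed.

End Cells.

(** * Homomorphisms into algebras with three spare dimensions *)

Section NoEmbedding.
Variables (k : nat) (K : kind).
Local Notation n := k.+3.
Local Notation srt := point_sort.
Local Notation col := (edge_colour k).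
Local Notation C := (Cm (At (definable_alg k K))).
Variables (J : eqType) (e : 'I_n -> J) (B : alg K J) (g : C -> reduct e B) (v : nat -> J).
Hypothesis e_inj : injective e.
Hypothesis varB : variety B.
Hypothesis g_hom : hom g.
Hypothesis g_neat : forall x, neat_universe e B (g x).
Hypothesis v_uniq : uniq [:: v 1; v 2; v 3].
Hypothesis ev : forall i t, t \in [:: 1; 2; 3]%N -> e i != v t.

Let pos (a : J) : 'I_n := odflt (zpos k) [pick i | e i == a].

Let pos_e i : pos (e i) = i.
Proof.
rewrite /pos; case: pickP => [j /eqP/e_inj //|/(_ i)]; by rewrite eqxx.
Qed.

Let W : seq 'I_n := [:: xpos k; ypos k; zpos k].

Definition image_cell R (a b : J) : B := g (@cell k K R (pos a) (pos b)).

Let g_cyl i x : @unop _ _ B (Cyl (e i)) (g x) = g (@unop _ _ C (Cyl i) x).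
Proof. by have [_ [_ [_ [_ [_ [-> _]]]]]] := g_hom. Qed.

Let g_repl i j x : @replacement K _ B (e i) (e j) (g x) = g (@replacement K _ C i j x).
Proof. by rewrite (replacement_hom i j x g_hom) replacement_reduct. Qed.

Let g_mono x y : x <= y -> (g x : B) <= g y.
Proof.
have [_ [_ [_ [gI _]]]] := g_hom.
by rewrite !leEmeet => /eqP xy; apply/eqP; rewrite -[LHS]/(_ : reduct e B) -gI xy.
Qed.

Let g_new t x : t \in [:: 1; 2; 3]%N -> @unop _ _ B (Cyl (v t)) (g x) = g x.
Proof. by move=> ht; apply: g_neat => i; apply/eqP/ev. Qed.

Let inW a : a \in map e W -> exists2 i, i \in W & a = e i.
Proof. by case/mapP => i; exists i. Qed.

Let vP l : l \in [:: v 1; v 2; v 3] -> exists2 t, t \in [:: 1; 2; 3]%N & l = v t.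
Proof.
by rewrite !inE => /or3P[]/eqP ->; [exists 1%N|exists 2%N|exists 3%N].
Qed.

Lemma image_cell_like R : cell_like (fun i => @unop _ _ B (Cyl i))
  (@replacement K _ B) (e (xpos k)) (e (ypos k)) (e (zpos k)) v (image_cell R).
Proof.
split=> [a b l|a b l].
  move=> /(@inW a)[i iW ->] /(@inW b)[j jW ->]; rewrite mem_cat => hl.
  rewrite /= !inE !negb_or andbT => /andP[/andP[_ il] jl].
  rewrite /image_cell; case/orP: hl => [/(@inW l)[m mW em]|/vP[t ht ->]].
    move: il jl; rewrite em !pos_e !(inj_eq e_inj) => im jm.
    by rewrite g_cyl cyl_cell // eq_sym.
  exact: g_new.
move=> /(@inW a)[i iW ->] /(@inW b)[j jW ->] /(@inW l)[m mW ->].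
rewrite /= !inE !(inj_eq e_inj) !negb_or andbT => /andP[/andP[ij im] jm].
rewrite /image_cell !pos_e !g_repl; split; congr (g _).
  by have [] := @replacement_cell k K R i j m iW mW; rewrite // eq_sym.
by have [] := @replacement_cell k K R j i m jW mW.
Qed.

Lemma image_le R R' R'' i j i' j' i'' j'' :
  (forall f, rhofree f -> cellP R i j f -> cellP R' i' j' f -> cellP R'' i'' j'' f) ->
  (image_cell R (e i) (e j) `&` image_cell R' (e i') (e j') : B)
    <= image_cell R'' (e i'') (e j'').
Proof.
move=> h; rewrite /image_cell !pos_e.
have [_ [_ [_ [gI _]]]] := g_hom.
rewrite -[X in X <= _](gI (@cell k K R i j) (@cell k K R' i' j')).
apply: g_mono; apply: Cm_le => a [].
have [f af] := point_rep a.
move=> /(atoms_inE (@cellP_invariant _ R i j) af) r1.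
move=> /(atoms_inE (@cellP_invariant _ R' i' j') af) r2.
apply/(atoms_inE (@cellP_invariant _ R'' i'' j'') af); apply: h => //.
exact: point_rhofree af.
Qed.

(** Formulated for homomorphisms, so that it applies to an embedding into a neat reduct as well as
    to one factor of a subdirect product. *)
Lemma no_embedding : g (atoms_in (apexP 1)) = \bot.
Proof.
have := W_uniq k; rewrite /= !inE negb_or andbT => /andP[/andP[xy xz] yz].
have dims : uniq [:: e (xpos k); e (ypos k); e (zpos k); v 1; v 2; v 3].
  rewrite -[X in uniq X]/(map e W ++ [:: v 1; v 2; v 3]) cat_uniq v_uniq andbT.
  rewrite map_inj_uniq // W_uniq andTb; apply/hasPn => _ /vP[t ht ->].
  by apply/mapP => -[i _ /eqP]; rewrite eq_sym (negbTE (ev i ht)).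
have eW a : a \in [:: e (xpos k); e (ypos k); e (zpos k)] ->
    exists2 i, i \in W & a = e i by exact: (@inW a).
have C0 := col_consistent k.
have GT (s : seq nat) : all predT s by apply/allP.
have [gb [gt [gU [gI _]]]] := g_hom.
have laws := variety_laws (_ : e (xpos k) != e (ypos k)) varB.
have {}laws := laws (etrans (congr1 negb (inj_eq e_inj _ _)) xy).
pose P t : B := g (atoms_in (apexP t)).
pose base : B := g (atoms_in (@baseP k)).
apply: (@core_contradiction _ B J _ _ laws _ _ _ v dims
  (fun t => image_cell (left_apex k t)) (fun t => image_cell (right_apex k t))
  (fun t u => image_cell (apex_pair k red_or_mark t u))
  (fun t u => image_cell (apex_pair k not_mark t u))
  (fun t u => image_cell (apex_pair k isred t u))
  (fun b t u => image_cell (apex_pair k (red_class b) t u))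
  P base).
- by move=> t; apply: image_cell_like.
- by move=> t; apply: image_cell_like.
- by move=> t u; apply: image_cell_like.
- by move=> t u; apply: image_cell_like.
- by move=> b t u; apply: image_cell_like.
- by move=> t l /vP[u hu ->]; apply: g_new.
- by move=> t t4; rewrite /P g_cyl cyl_apex.
- rewrite /base g_cyl; congr (g _); apply: cyl_cell; rewrite ?inE ?eqxx ?orbT //.
    by rewrite eq_sym.
  by rewrite eq_sym.
- move=> t; rewrite /image_cell !pos_e; apply: g_mono; apply: atoms_in_le => f _; by case.
- move=> t; rewrite /image_cell !pos_e; apply: g_mono; apply: atoms_in_le => f _; by case.
- move=> t u a b tu /eW[i iW ->] /eW[j jW ->] _; apply: image_le => f hf.
  move=> [pf [sx si ei]] [_ [_ sj ej]]; split=> //; split=> //.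
  apply: (consX C0 pf (GT _) sx) => //; rewrite ?si ?sj ?leq_addr //.
  by rewrite eqn_add2l neq_ltn tu.
- move=> t u a b tu /eW[i iW ->] /eW[j jW ->] _; apply: image_le => f hf.
  move=> [pf [sx si ei]] [_ [_ sj ej]]; split=> //; split=> //.
  apply: (consY C0 pf (GT _) sx) => //; rewrite ?si ?sj ?leq_addr //.
  by rewrite eqn_add2l neq_ltn tu.
- move=> t u a b /eW[i iW ->] /eW[j jW ->] _; apply: image_le => f hf.
  move=> [pf [si sj h1]] [_ [_ _ h2]]; split=> //; split=> //.
  by case/orP: h1 => // h1; rewrite /not_mark h1 in h2.
(* Atoms are free of [rho], so each red has a class; in the model itself this inclusion fails. *)
- move=> t a b /eW[i iW ->] /eW[j jW ->] _; rewrite /image_cell !pos_e.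
  rewrite -[X in _ <= X](gU (cell _ i j) (cell _ i j)); apply: g_mono.
  apply: Cm_le => c; have [f cf] := point_rep c.
  move=> /(atoms_inE (@cellP_invariant _ _ i j) cf) [pf [si sj]] hc.
  have := point_rhofree cf i j (size_ppos k).
  move: hc; case hcol: (col _ _ _) => [//|[[b' l]|]] // _ _.
  by case: b' hcol => hcol; [right|left];
    apply/(atoms_inE (@cellP_invariant _ _ i j) cf); split=> //; split=> //; rewrite hcol.
(* [mate] reverses the class, so the reds from the distinguished apex to two apexes joined by a red
   cannot share a class. *)
move=> b t u /andP[t0 tu].
rewrite /image_cell !pos_e.
rewrite -[X in _ <= X]gb -[X in _ `&` X <= _](gI (cell _ _ _) (cell _ _ _)).
rewrite -[X in X <= _](gI (cell _ _ _)); apply: g_mono; apply: Cm_le => c [].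
have [f cf] := point_rep c.
move=> /(atoms_inE (@cellP_invariant _ _ _ _) cf) [pf [sx sy r1]] [].
move=> /(atoms_inE (@cellP_invariant _ _ _ _) cf) [_ [sz _ r2]].
move=> /(atoms_inE (@cellP_invariant _ _ _ _) cf) [_ [_ _ r3]].
have redQ q : red_class b q -> isred q by case: q.
rewrite addn0 in sz.
have := consZ C0 pf (GT _) sz _ _ _ (redQ _ r2) (redQ _ r3) r1.
rewrite sx sy eqn_add2l -{1 3}[k.+2]addn0 !ltn_add2l t0 (ltn_trans t0 tu) neq_ltn tu.
move=> /(_ isT isT isT) E; move: r3; rewrite E; move: r2.
case: (col _ _ _) => // -[[b' l]|] //= /eqP -> .
by case: b'.
Qed.

End NoEmbedding.

(** * Set algebras inside neat reducts of larger set algebras *)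

Section Lift.
Variables (K : kind) (I J : eqType) (e : I -> J) (U : Type).
Hypothesis e_inj : injective e.

Definition lift (X : full_set_alg K I U) : reduct e (full_set_alg K J U) :=
  [set F : J -> U | (X : set (I -> U)) (F \o e)]%classic.

Lemma lift_hom : hom lift.
Proof.
split; first by [].
split; first by [].
split; first by [].
split; first by [].
split; first by [].
have rE i j (F : J -> U) : F \o e \o repl i j = F \o repl (e i) (e j) \o e.
  by apply: funext => l /=; rewrite /repl (inj_eq e_inj); case: eqP.
have tE i j (F : J -> U) : F \o e \o transp i j = F \o transp (e i) (e j) \o e.
  by apply: funext => l /=; rewrite /transp !(inj_eq e_inj); do 2 case: eqP => //.
split; last first.
  by case=> h i j.
case=> [i|h i j|h i j] X; apply: set_ext => F.
- split=> [[g Xg gF]|[G XG GF]]; last first.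
    by exists (G \o e) => // j ji; apply: GF; rewrite (inj_eq e_inj).
  exists (fun a => if a == e i then g i else F a); last by move=> a /negbTE ->.
  rewrite /lift /=; congr (X : set _) : Xg; apply: funext => l /=.
  by rewrite (inj_eq e_inj); case: eqP => [->|/eqP/gF].
- by rewrite /lift /= -[X _]/((X : set _) (F \o e \o repl i j)) rE.
by rewrite /lift /= -[X _]/((X : set _) (F \o e \o transp i j)) tE.
Qed.

Lemma lift_neat X : neat_universe e (full_set_alg K J U) (lift X).
Proof.
move=> a ea; apply: set_ext => F; split=> [[G XG GF]|XF]; last by exists F.
rewrite /lift /=; suff -> : F \o e = G \o e by [].
by apply: funext => i /=; rewrite GF //; apply/eqP/ea.
Qed.

Lemma lift_bot (i0 : I) X : lift X = \bot -> X = \bot.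
Proof.
move=> h; apply: set_ext => f; split=> // Xf.
pose F a := if pselect (exists i, e i = a) is left ea then f (sval (cid ea)) else f i0.
have Fe : F \o e = f.
  apply: funext => i; rewrite /F /=; case: pselect => [ea|[]]; last by exists i.
  by congr f; apply: e_inj; case: cid.
have : lift X F by rewrite /lift /= Fe.
by rewrite h.
Qed.

End Lift.

Lemma hom_comp K I (A B C : alg K I) (f : A -> B) (g : B -> C) :
  hom f -> hom g -> hom (g \o f).
Proof.
move=> [f0 [f1 [fU [fI [fC [fo fc]]]]]] [g0 [g1 [gU [gI [gC [go gc]]]]]].
split; first by rewrite /= f0.
split; first by rewrite /= f1.
split; first by move=> x y; rewrite /= fU.
split; first by move=> x y; rewrite /= fI.
split; first by move=> x; rewrite /= fC.
split; first by move=> o x; rewrite /= fo.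
by move=> c; rewrite /= fc.
Qed.

(** By counting: [e'] takes [n + 3] values and [e] at most [n]. The argument also covers infinite
    [J], and [e] may differ from the restriction of [e']. *)
Lemma new_dimensions n (J : eqType) (e : 'I_n -> J) (e' : 'I_(n + 3) -> J) :
  injective e' -> exists v : nat -> J, uniq [:: v 1; v 2; v 3] /\
    forall i t, t \in [:: 1; 2; 3]%N -> e i != v t.
Proof.
move=> e'i.
have [s [us ss sP]] : exists s, [/\ uniq s, (3 <= size s)%N &
    forall a, a \in s -> a \notin codom e].
  exists [seq a <- codom e' | a \notin codom e]; split.
  - by rewrite filter_uniq // map_inj_uniq // enum_uniq.
  - have sub : {subset codom e' <= [seq a <- codom e' | a \notin codom e] ++ codom e}.
      by move=> a ha; rewrite mem_cat mem_filter ha andbT orNb.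
    have := uniq_leq_size (_ : uniq (codom e')) sub.
    rewrite map_inj_uniq ?enum_uniq // => /(_ isT).
    by rewrite size_cat !size_codom !card_ord; move: (size _) => q; lia.
  by move=> a; rewrite mem_filter => /andP[].
case: s us ss sP => [|a [|b [|c s]]] // us _ sP.
exists (fun t => if t == 1%N then a else if t == 2%N then b else c); split.
  by move: us; rewrite -[_ :: _]/([:: a; b; c] ++ s) cat_uniq => /andP[].
have hs x : x \in [:: a; b; c] -> x \notin codom e.
  by move=> hx; apply: sP; rewrite -[_ :: _]/([:: a; b; c] ++ s) mem_cat hx.
move=> i t ht; apply: contraTneq (codom_f e i) => ->; apply: hs; rewrite !inE in ht.
by case/or3P: ht => /eqP ->; rewrite !inE eqxx ?orbT.
Qed.

Lemma initial_segment_inj k d (m : orderType d) (e : 'I_k -> m) :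
  initial_segment e -> injective e.
Proof.
move=> [mono _] i j eij; apply: val_inj.
by case: (ltngtP (val i) (val j)) => // /mono; rewrite eij ltxx.
Qed.

Theorem theorem2p7 (K : kind) (n : nat) (hn : (2 < n)%N)
    (d : Order.disp_t) (m : orderType d)
    (wf_m : well_founded (fun x y : m => (x < y)%O))
    (hm : ord_le (n + 3) m) :
  not_atom_canonical_wrt (@RK K n) (@SNrK K n d m) /\
  ~ atom_canonical (@RK K n).
Proof.
case: n hn hm => [|[|[|k]]] // _ [e' he'].
have e'i := initial_segment_inj he'.
split.
  exists (definable_alg k K); split; first exact: definable_RK.
  split; first exact: definable_atomic.
  split; first exact: definable_additive.
  move=> [A [[e [B [he [varB [g [g_hom [g_inj g_im]]]]]]] [f [f_hom f_inj]]]].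
  have [v [v_uniq ev]] := new_dimensions e e'i.
  have gf := hom_comp f_hom g_hom.
  apply: (@apex_nonempty k K); apply: f_inj; apply: g_inj.
  rewrite -[LHS]/((g \o f) _).
  rewrite (no_embedding (initial_segment_inj he) varB gf _ v_uniq ev); last first.
    by move=> x; apply/g_im; exists (f x).
  by have [gb _] := gf; rewrite -[RHS]/((g \o f) \bot) gb.
(* Every factor of a subdirect representation lies in a set algebra, which lifts to dimension
   [n + 3]; so every factor sends the nonzero element to zero, against separation. *)
move=> canon.
have := canon _ (@definable_RK k K) (@definable_atomic k K) (@definable_additive k K).
case=> _ [T [B [h [hB [h_hom [_ h_sep]]]]]].
apply: (@apex_nonempty k K); apply: h_sep => t.
have [_ [[U ->] [f [f_hom f_inj]]]] := hB t.
apply: f_inj; set n := k.+3.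
pose e (i : 'I_n) : 'I_(n + 3) := widen_ord (leq_addr 3 n) i.
have e_inj : injective e by move=> i j /(congr1 val) /= ij; apply: val_inj.
have [v [v_uniq ev]] := new_dimensions e (@inj_id 'I_(n + 3)).
have gf := hom_comp (hom_comp (h_hom t) f_hom) (lift_hom K U e_inj).
have [fb _] := hom_comp (h_hom t) f_hom.
rewrite -[LHS]/((f \o h t) _) -[RHS]/((f \o h t) _) [RHS]fb.
apply: (lift_bot e_inj (zpos k)).
apply: (no_embedding e_inj (variety_full K _ U) gf _ v_uniq ev) => x.
exact: lift_neat.
Qed.
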